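(* There is a $4$-factor approximation algorithm for the PrizeCollectingResAll problem.
   Context: PrizeCollectingResAll problem. Time is discretized into timeslots $1,\dots,T$. The input consists of a set $\mathcal{J}$ of jobs and a set $\mathcal{I}$ of resources. Each job $j$ is an interval $[s(j),e(j)]$ with integers $1\le s(j)\le e(j)\le T$, has demand $1$, and has a penalty $p_j\ge 0$. Each resource $i$ is an interval $[s(i),e(i)]\subseteq[1,T]$ with an integer capacity $w(i)$ and a cost $c(i)$. A job/resource is active at $t$ if $t$ lies in its interval. For a set $J$ of jobs, $P_J(t)$ is the number of jobs of $J$ active at $t$; for a multiset $R$ of resources, $P_R(t)=\sum_{i\in R\text{ active at }t}w(i)$ (with multiplicity). $R$ covers $J$ if $P_R(t)\ge P_J(t)$ for all $t$. A feasible solution is a pair $(R,J)$ with $R$ a multiset of resources (multiple copies allowed, each paid for), $J\subseteq\mathcal{J}$, and $R$ covering $J$. Its cost is the sum of costs of resources in $R$ (with multiplicity) plus $\sum_{j\in\mathcal{J}\setminus J}p_j$. The goal is to minimize cost. An approximation algorithm runs in polynomial time and outputs a feasible solution of cost at most the stated factor times the optimum. *)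

(* Defs.v *)
From HB Require Import structures.
From mathcomp Require Import all_boot all_order all_algebra.
From Stdlib Require Import Classical.

Set Implicit Arguments.
Unset Strict Implicit.
Unset Printing Implicit Defensive.

Import Order.TTheory GRing.Theory Num.Theory.

(** * Prize-collecting resource allocation *)

Local Open Scope ring_scope.

Record job := Job { job_start : nat; job_end : nat; penalty : rat }.

Record resource := Resource
  { res_start : nat; res_end : nat; capacity : int; price : rat }.

Record instance := Instance
  { horizon : nat; jobs : seq job; resources : seq resource }.

(* Jobs and resources are identified by their position in the sequence, so two
   distinct jobs may have the same interval and penalty. *)
Notation job_index I := 'I_(size (jobs I)).
Notation res_index I := 'I_(size (resources I)).
Notation get_job I j := (tnth (in_tuple (jobs I)) j).
Notation get_res I i := (tnth (in_tuple (resources I)) i).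

(* [price] must be nonnegative: otherwise buying more and more copies of a
   resource could make the cost arbitrarily negative. *)
Definition valid_job (T : nat) (j : job) : bool :=
  [&& 1 <= job_start j, job_start j <= job_end j & job_end j <= T]%N
  && (0 <= penalty j).

Definition valid_resource (T : nat) (i : resource) : bool :=
  [&& 1 <= res_start i, res_start i <= res_end i & res_end i <= T]%N
  && (0 <= price i).

Definition valid_instance (I : instance) : bool :=
  all (valid_job (horizon I)) (jobs I)
  && all (valid_resource (horizon I)) (resources I).

Definition job_active (j : job) (t : nat) : bool :=
  (job_start j <= t <= job_end j)%N.

Definition res_active (i : resource) (t : nat) : bool :=
  (res_start i <= t <= res_end i)%N.

(* A multiset of resources is given by its multiplicity function. *)
Record solution (I : instance) := Solution
  { copies : {ffun res_index I -> nat}; served : {set job_index I} }.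

Definition job_profile (I : instance) (J : {set job_index I}) (t : nat) : nat :=
  #|[set j in J | job_active (get_job I j) t]|.

Definition res_profile (I : instance) (R : {ffun res_index I -> nat})
    (t : nat) : int :=
  \sum_(i | res_active (get_res I i) t) capacity (get_res I i) *+ R i.

Definition covers (I : instance) (R : {ffun res_index I -> nat})
    (J : {set job_index I}) : Prop :=
  forall t : nat, (1 <= t <= horizon I)%N ->
    (job_profile J t)%:Z <= res_profile R t.

Definition feasible (I : instance) (S : solution I) : Prop :=
  covers (copies S) (served S).

Definition cost (I : instance) (S : solution I) : rat :=
  \sum_i price (get_res I i) *+ copies S i
  + \sum_(j | j \notin served S) penalty (get_job I j).

Definition optimal (I : instance) (S : solution I) : Prop :=
  feasible S /\ forall S' : solution I, feasible S' -> cost S <= cost S'.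

Lemma cost_ge0 (I : instance) (S : solution I) :
  valid_instance I -> 0 <= cost S.
Proof.
move=> /andP[vj vr]; apply: addr_ge0; apply: sumr_ge0 => k _.
  by rewrite mulrn_wge0 //; case/andP: (all_tnthP (t := in_tuple _) vr k).
by case/andP: (all_tnthP (t := in_tuple _) vj k).
Qed.

Lemma optimal_exists (I : instance) :
  valid_instance I -> exists S : solution I, optimal S.
Proof.
move=> vI.
pose D : int := (\prod_(i : res_index I) denq (price (get_res I i)))
  * (\prod_(j : job_index I) denq (penalty (get_job I j))).
have D_gt0 : 0 < D by apply: mulr_gt0; apply: prodr_gt0 => k _; exact: denq_gt0.
have DQ_gt0 : 0 < D%:~R :> rat by rewrite ltr0z.
have clear q z : q * (denq q * z)%:~R \is a Num.int.
  by rewrite intrM mulrA -numqE -intrM intr_int.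
have Dr i : price (get_res I i) * D%:~R \is a Num.int.
  by rewrite /D (bigD1 i) //= -mulrA clear.
have Dj j : penalty (get_job I j) * D%:~R \is a Num.int.
  by rewrite /D [X in X%:~R]mulrC (bigD1 j) //= -mulrA clear.
have costD (S : solution I) : exists k : nat, cost S * D%:~R = k%:R.
  apply/natrP; rewrite natrEint mulr_ge0 ?cost_ge0 ?(ltW DQ_gt0) // andbT.
  rewrite mulrDl !mulr_suml rpredD // rpred_sum // => k _.
  by rewrite mulrnAl rpredMn.
suff main k (S : solution I) : feasible S -> cost S * D%:~R = k%:R ->
    exists S' : solution I, optimal S'.
  have [k Ek] := costD (Solution [ffun=> 0%N] set0).
  apply: (main k _ _ Ek) => t _; rewrite /res_profile /job_profile /=.
  rewrite big1 => [|i _]; last by rewrite ffunE.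
  by rewrite (_ : [set _ in _ | _] = set0) ?cards0 //; apply/setP=> j; rewrite !inE.
elim/ltn_ind: k S => k IH S fS Ek.
case: (classic (optimal S)) => [oS | noS]; first by exists S.
have [S' [fS' ltS']] :
    exists S' : solution I, feasible S' /\ cost S' < cost S.
  apply: NNPP => no; apply: noS; split=> // S' fS'.
  by rewrite leNgt; apply/negP => lt; apply: no; exists S'.
have [k' Ek'] := costD S'; apply: (IH k' _ S' fS' Ek').
by rewrite -(ltr_nat rat) -Ek -Ek' ltr_pM2r.
Qed.

Local Close Scope ring_scope.

(** * Random access machines with logarithmic cost

   Structured programs over finitely many (statically named) infinite arrays of
   natural numbers, with indirect addressing; a scalar variable is cell 0 of an
   array. Every operation is charged the bit lengths of the addresses and
   numbers it handles, so that running times agree with those of Turing machines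
   up to a polynomial. *)

Definition bitlen (n : nat) : nat := (trunc_log 2 n).+1.

Inductive binop := Add | Sub | Mul | Div | Leq | Eql.

(* [Sub] is truncated and [Div] by zero yields zero; tests yield 0 or 1. *)
Definition binop_val (o : binop) (m n : nat) : nat :=
  match o with
  | Add => m + n
  | Sub => m - n
  | Mul => m * n
  | Div => m %/ n
  | Leq => m <= n
  | Eql => m == n
  end.

Inductive expr :=
  | Const of nat
  | Read of nat & expr                (* array name, address *)
  | Binop of binop & expr & expr.

Inductive program :=
  | Skip
  | Write of nat & expr & expr        (* array name, address, new contents *)
  | Seq of program & program
  | If of expr & program & program    (* a nonzero number counts as true *)
  | While of expr & program.

Definition store := nat -> nat -> nat.

Definition update (s : store) (a i v : nat) : store :=
  fun a' i' => if (a' == a) && (i' == i) then v else s a' i'.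

Fixpoint eval (s : store) (e : expr) : nat :=
  match e with
  | Const n => n
  | Read a e1 => s a (eval s e1)
  | Binop o e1 e2 => binop_val o (eval s e1) (eval s e2)
  end.

Fixpoint eval_time (s : store) (e : expr) : nat :=
  match e with
  | Const n => bitlen n
  | Read a e1 => eval_time s e1 + bitlen (eval s e1) + bitlen (eval s e)
  | Binop o e1 e2 =>
      eval_time s e1 + eval_time s e2 + bitlen (eval s e1) + bitlen (eval s e2)
  end.

(* [exec c s t s']: started in [s], [c] halts in [s'] after time [t]. *)
Inductive exec : program -> store -> nat -> store -> Prop :=
  | ExecSkip s : exec Skip s 1 s
  | ExecWrite s a e1 e2 :
      exec (Write a e1 e2) s
        (eval_time s e1 + eval_time s e2
         + bitlen (eval s e1) + bitlen (eval s e2))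
        (update s a (eval s e1) (eval s e2))
  | ExecSeq c1 c2 s s1 s2 t1 t2 :
      exec c1 s t1 s1 -> exec c2 s1 t2 s2 -> exec (Seq c1 c2) s (t1 + t2) s2
  | ExecIfTrue e c1 c2 s s1 t :
      eval s e != 0 -> exec c1 s t s1 ->
      exec (If e c1 c2) s (eval_time s e + t) s1
  | ExecIfFalse e c1 c2 s s1 t :
      eval s e = 0 -> exec c2 s t s1 ->
      exec (If e c1 c2) s (eval_time s e + t) s1
  | ExecWhileTrue e c s s1 s2 t1 t2 :
      eval s e != 0 -> exec c s t1 s1 -> exec (While e c) s1 t2 s2 ->
      exec (While e c) s (eval_time s e + t1 + t2) s2
  | ExecWhileFalse e c s :
      eval s e = 0 -> exec (While e c) s (eval_time s e) s.

(* Array 0 holds the input, array 1 the output, each preceded by its length;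
   all other cells are initially zero. *)
Definition input_store (x : seq nat) : store :=
  fun a i => if a == 0 then nth 0 (size x :: x) i else 0.

Definition output (s : store) : seq nat :=
  mkseq (fun i => s 1 i.+1) (s 1 0).

Definition input_length (x : seq nat) : nat := \sum_(n <- x) bitlen n.

(** * Approximation algorithms *)

(* No sign is encoded: penalties and prices are nonnegative in a valid
   instance. *)
Definition encode_rat (q : rat) : seq nat := [:: absz (numq q); absz (denq q)].

Definition encode_job (j : job) : seq nat :=
  [:: job_start j; job_end j] ++ encode_rat (penalty j).

Definition encode_resource (i : resource) : seq nat :=
  [:: res_start i; res_end i; nat_of_bool (capacity i < 0)%R; absz (capacity i)]
  ++ encode_rat (price i).

Definition encode_instance (I : instance) : seq nat :=
  [:: horizon I; size (jobs I); size (resources I)]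
  ++ flatten (map encode_job (jobs I))
  ++ flatten (map encode_resource (resources I)).

Definition encode_solution (I : instance) (S : solution I) : seq nat :=
  [seq copies S i | i <- enum (res_index I)]
  ++ [seq nat_of_bool (j \in served S) | j <- enum (job_index I)].

(* Running time is measured against the bit length of the input, in which the
   horizon, interval endpoints, capacities, penalties and costs are all written
   in binary; [p] depends on the algorithm only. *)
Definition approximation_algorithm (alpha : rat) (A : program) : Prop :=
  exists p : {poly nat}, forall I : instance, valid_instance I ->
    exists (t : nat) (s : store) (S : solution I),
      [/\ exec A (input_store (encode_instance I)) t s,
          t <= (p.[input_length (encode_instance I)])%R,
          output s = encode_solution S,
          feasible S
        & forall O : solution I, optimal O -> (cost S <= alpha * cost O)%R].

(* Main.v *)
Require Import Defs.
From mathcomp Require Import all_boot all_order all_algebra.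
From mathcomp Require Import zify.
From Stdlib Require Import FunctionalExtensionality.

(* Rejecting a job amounts to buying a unit-capacity item on its interval, at
   most once, and more than n copies of a resource are never useful (n is the
   number of jobs). So one has to cover the demand, the number of jobs active at
   each time, by N items of bounded multiplicity, and only the 2N interval
   endpoints matter as times.

   Local ratio: while the chosen items leave a deficit, take a time t of maximal
   deficit D and charge each unchosen item active at t in proportion to
   min(capacity, D), as much as the residual prices permit; then choose all
   copies of an item whose residual price has dropped to 0. Every cover pays at
   least D per unit of charge. In the end, go through the chosen items in reverse
   order and drop copies as long as the rest is a cover. A remaining item is
   essential at some time. Among the items charged in a given round, those
   essential at a time before t are all active at the last such time, where
   without one copy of one of them the deficit D of that round would not be
   filled; so they pay at most 2 D per unit of charge, and so do those essential
   after t, which gives the factor 4.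

   Residual prices are kept integral by multiplying all of them by the
   denominator of the charge, which is at most n; so they have polynomially many
   bits after the N rounds. *)

Set Implicit Arguments.
Unset Strict Implicit.
Unset Printing Implicit Defensive.

(** * A loop language and its compilation *)

(* [ASum l e] is the sum of [e] over all values of the loop variable below cell
   [l] of the array [LIM]; [FFor l c] iterates [c] over the same values. [AVar k]
   is the loop variable of the k-th enclosing sum or loop. *)
Inductive aexp :=
  | AConst of nat
  | AVar of nat
  | ARead of nat & aexp
  | ABin of binop & aexp & aexp
  | ASum of nat & aexp.

Inductive fprog :=
  | FWrite of nat & aexp & aexp
  | FSeq of fprog & fprog
  | FFor of nat & fprog.

Definition LIM := 2.

Fixpoint aval (s : store) (env : seq nat) (e : aexp) : nat :=
  match e with
  | AConst n => n
  | AVar k => nth 0 env k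
  | ARead a e1 => s a (aval s env e1)
  | ABin o e1 e2 => binop_val o (aval s env e1) (aval s env e2)
  | ASum l e1 => \sum_(i < s LIM l) aval s (val i :: env) e1
  end.

Fixpoint frun (env : seq nat) (c : fprog) (s : store) : store :=
  match c with
  | FWrite a e1 e2 => update s a (aval s env e1) (aval s env e2)
  | FSeq c1 c2 => frun env c2 (frun env c1 s)
  | FFor l c1 => iteri (s LIM l) (fun i => frun (i :: env) c1) s
  end.

(* Array [a] of the loop language is array [bump TMP a] of the machine. *)
Definition TMP := 2.
Definition tmp (i : nat) : expr := Read TMP (Const i).
Definition set_tmp (i : nat) (e : expr) : program := Write TMP (Const i) e.
Definition next (i : nat) : expr := Binop Add (tmp i) (Const 1).

Fixpoint acomp (ctx : seq nat) (d : nat) (e : aexp) : program :=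
  match e with
  | AConst n => set_tmp d (Const n)
  | AVar k => set_tmp d (tmp (nth 0 ctx k))
  | ARead a e1 => Seq (acomp ctx d e1) (set_tmp d (Read (bump TMP a) (tmp d)))
  | ABin o e1 e2 =>
      Seq (acomp ctx d e1)
        (Seq (acomp ctx d.+1 e2) (set_tmp d (Binop o (tmp d) (tmp d.+1))))
  | ASum l e1 =>
      Seq (set_tmp d (Const 0))
        (Seq (set_tmp d.+1 (Const 0))
          (Seq (set_tmp d.+2 (Read (bump TMP LIM) (Const l)))
            (While (Binop Leq (next d.+1) (tmp d.+2))
              (Seq (acomp (d.+1 :: ctx) d.+3 e1)
                (Seq (set_tmp d (Binop Add (tmp d) (tmp d.+3)))
                  (set_tmp d.+1 (next d.+1)))))))
  end.

Fixpoint fcomp (ctx : seq nat) (d : nat) (c : fprog) : program :=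
  match c with
  | FWrite a e1 e2 =>
      Seq (acomp ctx d e1)
        (Seq (acomp ctx d.+1 e2) (Write (bump TMP a) (tmp d) (tmp d.+1)))
  | FSeq c1 c2 => Seq (fcomp ctx d c1) (fcomp ctx d c2)
  | FFor l c1 =>
      Seq (set_tmp d (Const 0))
        (Seq (set_tmp d.+1 (Read (bump TMP LIM) (Const l)))
          (While (Binop Leq (next d) (tmp d.+1))
            (Seq (fcomp (d :: ctx) d.+2 c1) (set_tmp d (next d)))))
  end.

(* One number serves two purposes: [abits b e] bounds the bit length of every
   intermediate value and also the depth of the stack of temporaries. *)
Fixpoint abits (b : nat) (e : aexp) : nat :=
  match e with
  | AConst n => b + n + 3
  | AVar k => b + 3
  | ARead a e1 => abits b e1 + b + 3
  | ABin o e1 e2 => abits b e1 + abits b e2 + 3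
  | ASum l e1 => abits b e1 + b + l + 3
  end.

Fixpoint fbits (b : nat) (c : fprog) : nat :=
  match c with
  | FWrite a e1 e2 => abits b e1 + abits b e2 + 3
  | FSeq c1 c2 => fbits b c1 + fbits b c2
  | FFor l c1 => fbits b c1 + b + l + 3
  end.

(** This counts elementary machine steps, each charged one unit later, with [L] bounding the
    iterations of a loop. In a sum, the 3 units per iteration pay for the test, the addition and the
    increment; the final 4 pay for three initializations and the last test. *)
Fixpoint acost (L : nat) (e : aexp) : nat :=
  match e with
  | AConst _ | AVar _ => 1
  | ARead _ e1 => acost L e1 + 1
  | ABin _ e1 e2 => acost L e1 + acost L e2 + 1
  | ASum _ e1 => L * (acost L e1 + 3) + 4
  end.

Fixpoint fcost (L : nat) (c : fprog) : nat :=
  match c with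
  | FWrite _ e1 e2 => acost L e1 + acost L e2 + 1
  | FSeq c1 c2 => fcost L c1 + fcost L c2
  | FFor _ c1 => L * (fcost L c1 + 2) + 3
  end.

(** Cells may hold [b]-bit numbers, but loop limits are bounded by [L] itself: a loop of length
    [2 ^ b] would not be polynomial. *)
Definition bounded (b L : nat) (s : store) : Prop :=
  (forall a i, s a i < 2 ^ b) /\ (forall l, s LIM l <= L).

(** The bounds are required after every assignment of the run, since the cost of each machine step
    depends on the numbers present at that moment. *)
Fixpoint safe (b L : nat) (env : seq nat) (c : fprog) (s : store) : Prop :=
  match c with
  | FWrite _ _ _ => bounded b L (frun env c s)
  | FSeq c1 c2 => safe b L env c1 s /\ safe b L env c2 (frun env c1 s)
  | FFor l c1 => forall i, i < s LIM l ->
      safe b L (i :: env) c1 (iteri i (fun i => frun (i :: env) c1) s)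
  end.

Lemma safe_bounded b L c : forall env s,
  bounded b L s -> safe b L env c s -> bounded b L (frun env c s).
Proof.
elim: c => [a e1 e2|c1 IH1 c2 IH2|l c IH] env s //=.
  by move=> bs [s1 s2]; apply/IH2/s2/IH1.
move=> bs sc.
have H k : k <= s LIM l -> bounded b L (iteri k (fun i => frun (i :: env) c) s).
  elim: k => [|k IHk] //= lk; apply: IH; last exact: sc.
  by apply: IHk; apply: ltnW.
exact: H.
Qed.

(** * Size of the values of expressions *)

Lemma bitlen_le n w : n < 2 ^ w -> bitlen n <= w.+1.
Proof.
rewrite /bitlen ltnS; case: n => [|n] lt; first by rewrite trunc_log0.
rewrite -ltnS -(ltn_exp2l _ _ (isT : 1 < 2)).
apply: leq_ltn_trans (trunc_logP (isT : 1 < 2) (isT : 0 < n.+1)) _.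
by apply: ltn_trans lt _; rewrite ltn_exp2l.
Qed.

Lemma abits_ge b e : b + 3 <= abits b e.
Proof. by elim: e => /= *; lia. Qed.

Lemma binop_val_lt o x y p q :
  x < 2 ^ p -> y < 2 ^ q -> binop_val o x y < 2 ^ (p + q + 1).
Proof.
move=> xp yq; have p0 : 0 < 2 ^ p by rewrite expn_gt0.
have q0 : 0 < 2 ^ q by rewrite expn_gt0.
have E : 2 ^ (p + q + 1) = 2 ^ p * 2 ^ q * 2 by rewrite !expnD expn1.
have pp : 2 ^ p <= 2 ^ p * 2 ^ q by rewrite leq_pmulr.
have qq : 2 ^ q <= 2 ^ p * 2 ^ q by rewrite leq_pmull.
rewrite E; case: o => /=.
- lia.
- lia.
- have : x * y < 2 ^ p * 2 ^ q by apply: ltn_mul.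
  lia.
- have : x %/ y <= x by apply: leq_div.
  lia.
- by case: (x <= y); lia.
- by case: (x == y); lia.
Qed.

Definition small (b : nat) (env : seq nat) := forall k, nth 0 env k < 2 ^ b.

Lemma small_cons b i env : i < 2 ^ b -> small b env -> small b (i :: env).
Proof. by move=> ib eb [|k] /=. Qed.

Lemma aval_lt b s e : (forall a i, s a i < 2 ^ b) -> forall env, small b env ->
  aval s env e < 2 ^ abits b e.
Proof.
move=> bs; have up x p q : x < 2 ^ p -> p <= q -> x < 2 ^ q.
  by move=> xp pq; apply: leq_trans xp _; rewrite leq_exp2l.
elim: e => [n|k|a e IH|o e1 IH1 e2 IH2|l e IH] env eb /=.
- by apply: up (ltn_expl n (isT : 1 < 2)) _; lia.
- by apply: up (eb k) _; lia.
- by apply: up (bs a _) _; lia.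
- by apply: up (binop_val_lt o (IH1 _ eb) (IH2 _ eb)) _; lia.
(* The number of terms is itself a cell, hence below [2 ^ b]. *)
- apply: (@up _ (abits b e + b)); last lia.
  apply: (@leq_ltn_trans (s LIM l * 2 ^ abits b e)).
    rewrite (_ : s LIM l * _ = \sum_(i < s LIM l) 2 ^ abits b e); last first.
      by rewrite sum_nat_const card_ord.
    apply: leq_sum => i _; apply/ltnW/IH/small_cons => //.
    exact: ltn_trans (ltn_ord i) (bs _ _).
  by rewrite expnD mulnC ltn_pmul2l ?expn_gt0 // bs.
Qed.

(** * Machine loops and the simulation relation *)

Lemma exec_set_tmp s i e : exec (set_tmp i e) s
  (bitlen i + eval_time s e + bitlen i + bitlen (eval s e))
  (update s TMP i (eval s e)).
Proof. exact: ExecWrite. Qed.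

Lemma updateE s a i v : update s a i v a i = v.
Proof. by rewrite /update !eqxx. Qed.

Lemma update_cell s a i v j : j != i -> update s a i v a j = s a j.
Proof. by move=> ji; rewrite /update (negbTE ji) andbF. Qed.

Lemma update_array s a i v a' j : a' != a -> update s a i v a' j = s a' j.
Proof. by move=> aa; rewrite /update (negbTE aa). Qed.

(** The invariant [P] pins the counter cell [i] and the limit cell [j], so the test succeeds exactly
    [n] times; [20 * U] generously pays for one test. The test looks at the counter plus one, hence
    bit lengths up to that of [n.+1]. *)
Lemma while_up i j body n (P : nat -> store -> Prop) T U :
  (forall k s, P k s -> s TMP i = k /\ s TMP j = n) ->
  (forall k s, k < n -> P k s ->
     exists t s', [/\ exec body s t s', P k.+1 s' & t <= T]) ->
  bitlen i <= U -> bitlen j <= U -> bitlen 1 <= U ->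
  (forall k, k <= n.+1 -> bitlen k <= U) ->
  forall s, P 0 s -> exists t s',
    [/\ exec (While (Binop Leq (next i) (tmp j)) body) s t s', P n s'
       & t <= n * (T + 20 * U) + 20 * U].
Proof.
move=> Pc Pb iU jU oneU nU s P0.
have cond k s' : k <= n -> P k s' ->
    eval_time s' (Binop Leq (next i) (tmp j)) <= 20 * U.
  move=> kn /Pc[Ei Ej] /=; rewrite Ei Ej.
  have := nU k (leqW kn); have := nU n (leqnSn n).
  by have := nU (k + 1); rewrite addn1 ltnS => /(_ kn); lia.
have loop d : forall k s', k + d = n -> P k s' -> exists t s'',
    [/\ exec (While (Binop Leq (next i) (tmp j)) body) s' t s'', P n s''
       & t <= d * (T + 20 * U) + 20 * U].
  elim: d => [|d IH] k s' kd Pk; have [Ei Ej] := Pc _ _ Pk.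
    rewrite addn0 in kd; rewrite {}kd in Pk Ei *.
    exists (eval_time s' (Binop Leq (next i) (tmp j))), s'; split=> //.
      by apply: ExecWhileFalse; rewrite /= Ei Ej addn1 ltnn.
    by rewrite mul0n; apply: cond Pk.
  have kn : k < n by lia.
  have [t1 [s1 [x1 P1 le1]]] := Pb _ _ kn Pk.
  have [|t2 [s2 [x2 P2 le2]]] := IH k.+1 s1 _ P1; first by lia.
  eexists; exists s2; split; [apply: ExecWhileTrue x1 x2 | exact: P2 |].
    by rewrite /= Ei Ej addn1 kn.
  by have := cond _ _ (ltnW kn) Pk; rewrite mulSn; lia.
exact: (loop n 0 s).
Qed.

(** [ctx] lists the temporaries that hold the loop variables. Past its end the default address is 0,
    and the default value of a loop variable is 0 as well; so temporary 0 must stay 0, and the third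
    clause forces [d] to be positive. *)
Definition holds_at (ctx : seq nat) (d : nat) (env : seq nat) (s r : store) :=
  [/\ forall a i, r (bump TMP a) i = s a i,
      forall k, r TMP (nth 0 ctx k) = nth 0 env k
    & forall k, nth 0 ctx k < d].

Definition keeps (d : nat) (r r' : store) :=
  (forall i, i < d -> r' TMP i = r TMP i)
  /\ (forall a i, a != TMP -> r' a i = r a i).

Lemma keeps_trans d r1 r2 r3 : keeps d r1 r2 -> keeps d r2 r3 -> keeps d r1 r3.
Proof.
move=> [A1 B1] [A2 B2]; split=> [i id|a i aT]; first by rewrite A2 ?A1.
by rewrite B2 ?B1.
Qed.

Lemma keeps_le d d' r r' : d <= d' -> keeps d' r r' -> keeps d r r'.
Proof. by move=> dd [A B]; split=> // i id; apply: A; apply: leq_trans dd. Qed.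

Lemma keeps_update d i v r : d <= i -> keeps d r (update r TMP i v).
Proof.
move=> di; split=> [j jd|a j aT]; last by rewrite update_array.
by rewrite update_cell //; apply: contraTneq (leq_trans jd di) => ->; rewrite ltnn.
Qed.

Lemma bumpTMP a : bump TMP a != TMP.
Proof. by rewrite eq_sym neq_bump. Qed.

Lemma holds_keeps ctx d env s r r' :
  holds_at ctx d env s r -> keeps d r r' -> holds_at ctx d env s r'.
Proof.
move=> [A B C] [D E]; split=> // [a i|k]; first by rewrite E ?bumpTMP.
by rewrite D.
Qed.

Lemma holds_le ctx d d' env s r :
  d <= d' -> holds_at ctx d env s r -> holds_at ctx d' env s r.
Proof. by move=> dd [A B C]; split=> // k; apply: leq_trans (C k) dd. Qed.

Lemma holds_cons ctx d d' env s r : d < d' ->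
  holds_at ctx d' env s r -> holds_at (d :: ctx) d' (r TMP d :: env) s r.
Proof. by move=> dd [A B C]; split=> // -[|k] /=. Qed.

(** * Correctness and cost of compiled code *)

Section Compile.

Variables (b L w : nat).
Let U := 20 * w.+1.

Lemma bitlen_up n p : n < 2 ^ p -> p <= w -> bitlen n <= w.+1.
Proof.
by move=> np pw; apply/bitlen_le/(leq_trans np); rewrite leq_exp2l.
Qed.

Lemma bitlen_id n : n <= w -> bitlen n <= w.+1.
Proof. by move=> nw; apply: bitlen_up nw; apply: ltn_expl. Qed.

Lemma set_tmp_spec d e r :
  bitlen d <= w.+1 -> bitlen (eval r e) <= w.+1 ->
  eval_time r e <= 17 * w.+1 ->
  exists t r', [/\ exec (set_tmp d e) r t r', t <= U,
    r' TMP d = eval r e, keeps d r r'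
    & forall i, i != d -> r' TMP i = r TMP i].
Proof.
move=> dw vw tw; do 2!eexists; split; first exact: exec_set_tmp.
- by rewrite /U; lia.
- exact: updateE.
- exact: keeps_update.
- by move=> i id; apply: update_cell.
Qed.

(** The budget [d + abits b e <= w] is inherited by subexpressions: [d] grows by at most the amount
    that [abits] loses. The same [w] bounds the bits of all values by [aval_lt] and the addresses of
    the temporaries. *)
Lemma acomp_spec s : bounded b L s -> forall e env ctx d r,
  small b env -> holds_at ctx d env s r -> d + abits b e <= w ->
  exists t r', [/\ exec (acomp ctx d e) r t r', t <= acost L e * U,
    r' TMP d = aval s env e & keeps d r r'].
Proof.
move=> [bs limL]; elim=> [n|k|a e IH|o e1 IH1 e2 IH2|l e IH] env ctx d r eb H /= dw.
- have nb : bitlen n <= w.+1 by apply: bitlen_id; lia.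
  have db : bitlen d <= w.+1 by apply: bitlen_id; lia.
  have [||/=|t [r' [x tU v K _]]] := @set_tmp_spec d (Const n) r; rewrite //=; try lia.
  by exists t, r'; split=> //; lia.
- have vb : bitlen (nth 0 env k) <= w.+1 by apply: bitlen_up (eb k) _; lia.
  case: (H) => A B C.
  have cb : bitlen (nth 0 ctx k) <= w.+1.
    by apply: bitlen_id; have := C k; lia.
  have db : bitlen d <= w.+1 by apply: bitlen_id; lia.
  have [|/=|/=|t [r' [x tU v K _]]] := @set_tmp_spec d (tmp (nth 0 ctx k)) r;
    rewrite /= ?B //=; try lia.
  exists t, r'; split=> //; first by lia.
  by rewrite v /= B.
- have [|t1 [r1 [x1 t1U v1 K1]]] := IH env ctx d r eb H; first by lia.
  have [A B C] := holds_keeps H K1.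
  have vb : bitlen (aval s env e) <= w.+1.
    by apply: bitlen_up (aval_lt e bs eb) _; lia.
  have vb' : bitlen (s a (aval s env e)) <= w.+1.
    by apply: bitlen_up (bs _ _) _; have := abits_ge b e; lia.
  have db : bitlen d <= w.+1 by apply: bitlen_id; lia.
  have [||/=|t [r' [x tU v K _]]] := @set_tmp_spec d (Read (bump TMP a) (tmp d)) r1;
    rewrite /= ?v1 ?A //=; try lia.
  exists (t1 + t), r'; split; [exact: ExecSeq x1 x | lia | | exact: keeps_trans K].
  by rewrite v /= v1 A.
- have [|t1 [r1 [x1 t1U v1 K1]]] := IH1 env ctx d r eb H; first by lia.
  have H1 := holds_le (leqnSn d) (holds_keeps H K1).
  have [|t2 [r2 [x2 t2U v2 K2]]] := IH2 env ctx d.+1 r1 eb H1.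
    by have := abits_ge b e1; lia.
  have v1' : r2 TMP d = aval s env e1 by rewrite K2.1.
  have vb1 : bitlen (aval s env e1) <= w.+1.
    by apply: bitlen_up (aval_lt e1 bs eb) _; lia.
  have vb2 : bitlen (aval s env e2) <= w.+1.
    by apply: bitlen_up (aval_lt e2 bs eb) _; lia.
  have db : bitlen d <= w.+1 by apply: bitlen_id; lia.
  have db' : bitlen d.+1 <= w.+1 by apply: bitlen_id; have := abits_ge b e1; lia.
  have vb3 : bitlen (binop_val o (aval s env e1) (aval s env e2)) <= w.+1.
    by apply: bitlen_up (binop_val_lt o (aval_lt e1 bs eb) (aval_lt e2 bs eb)) _; lia.
  have [||/=|t [r' [x tU v K _]]] := @set_tmp_spec d (Binop o (tmp d) (tmp d.+1)) r2;
    rewrite /= ?v1' ?v2 //=; try lia.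
  exists (t1 + (t2 + t)), r'; split.
  + exact: ExecSeq x1 (ExecSeq x2 x).
  + lia.
  + by rewrite v /= v1' v2.
  + by apply: keeps_trans K1 (keeps_trans (keeps_le _ K2) K); apply: leqnSn.
- have Db i : i <= 3 -> bitlen (d + i) <= w.+1.
    by move=> i3; apply: bitlen_id; have := abits_ge b e; lia.
  have db0 : bitlen d <= w.+1 by rewrite -[d]addn0 Db.
  have db1 : bitlen d.+1 <= w.+1 by rewrite -addn1 Db.
  have db2 : bitlen d.+2 <= w.+1 by rewrite -addn2 Db.
  have db3 : bitlen d.+3 <= w.+1 by rewrite -addn3 Db.
  have zb : bitlen 0 <= w.+1 by apply: bitlen_id.
  have ob : bitlen 1 <= w.+1 by apply: bitlen_id; lia.
  have lb : bitlen l <= w.+1 by apply: bitlen_id; lia.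
  pose n := s LIM l.
  have nb : n < 2 ^ b by apply: bs.
  have nb' : bitlen n <= w.+1 by apply: bitlen_up nb _; have := abits_ge b e; lia.
  have [||/=|t0 [r0 [x0 t0U v0 K0 F0]]] := @set_tmp_spec d (Const 0) r;
    rewrite //=; try lia.
  have [||/=|t1 [r1 [x1 t1U v1 K1 F1]]] := @set_tmp_spec d.+1 (Const 0) r0;
    rewrite //=; try lia.
  have K1' := keeps_trans K0 (keeps_le (leqnSn d) K1).
  have [A1 _ _] := holds_keeps H K1'.
  have [|/=|/=|t2 [r2 [x2 t2U v2 K2 F2]]] :=
    @set_tmp_spec d.+2 (Read (bump TMP LIM) (Const l)) r1;
    rewrite /= ?A1 //=; try (by rewrite -/n; lia).
  have K2' : keeps d r r2 by apply: keeps_trans K1' (keeps_le _ K2); lia.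
  pose S k := \sum_(i < k) aval s (val i :: env) e.
  (* Partial sums are at most the full sum, so the bound on the value of the whole expression holds
     for the accumulator throughout. *)
  have Sb k : k <= n -> S k < 2 ^ (abits b e + b + l + 3).
    move=> kn; apply: leq_ltn_trans (aval_lt (ASum l e) bs eb).
    rewrite /= /S -!(big_mkord xpredT (fun i => aval s (i :: env) e)).
    by rewrite (big_cat_nat (n := k) (p := s LIM l)) //= leq_addr.
  pose P k r' := [/\ keeps d r r', r' TMP d = S k, r' TMP d.+1 = k
    & r' TMP d.+2 = n].
  have P0 : P 0 r2.
    split=> //.
    + by rewrite F2 ?F1 ?v0 /S ?big_ord0 //; lia.
    + by rewrite F2 ?v1 //; lia.
    + by rewrite v2 /= A1.
  have [|||t3 [r3 [x3 [K3 v3 _ _] t3U]]] := @while_up d.+1 d.+2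
    (Seq (acomp (d.+1 :: ctx) d.+3 e)
      (Seq (set_tmp d (Binop Add (tmp d) (tmp d.+3))) (set_tmp d.+1 (next d.+1))))
    n P ((acost L e + 2) * U) w.+1 _ _ db1 db2 ob _ r2 P0.
  + by move=> k r' [].
  + move=> k r' kn [K' vd vd1 vd2].
    have kb : k < 2 ^ b by apply: ltn_trans nb.
    have H' : holds_at (d.+1 :: ctx) d.+3 (k :: env) s r'.
      rewrite -vd1; apply: holds_cons => //.
      by apply: holds_le (holds_keeps H K'); lia.
    have [|u1 [q1 [y1 u1U w1 Q1]]] := IH _ _ d.+3 r' (small_cons kb eb) H'; first by lia.
    have E1 : q1 TMP d = S k by rewrite Q1.1 //; lia.
    have ab : bitlen (aval s (k :: env) e) <= w.+1.
      by apply: bitlen_up (aval_lt e bs (small_cons kb eb)) _; lia.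
    have SE : S k + aval s (k :: env) e = S k.+1 by rewrite /S big_ord_recr.
    have sb : bitlen (S k) <= w.+1 by apply: bitlen_up (Sb _ (ltnW kn)) _; lia.
    have sb' : bitlen (S k.+1) <= w.+1 by apply: bitlen_up (Sb _ kn) _; lia.
    have [|/=|/=|u2 [q2 [y2 u2U w2 Q2 G2]]] :=
      @set_tmp_spec d (Binop Add (tmp d) (tmp d.+3)) q1;
      rewrite /= ?E1 ?w1 ?SE //=; try lia.
    have E2 : q2 TMP d.+1 = k by rewrite G2 ?Q1.1 //; lia.
    have kb' : bitlen k.+1 <= w.+1.
      by apply: (@bitlen_up _ b); [exact: leq_ltn_trans nb | have := abits_ge b e; lia].
    have kb2 : bitlen k <= w.+1.
      by apply: (@bitlen_up _ b) => //; have := abits_ge b e; lia.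
    have [|/=|/=|u3 [q3 [y3 u3U w3 Q3 G3]]] := @set_tmp_spec d.+1 (next d.+1) q2;
      rewrite /= ?E2 ?addn1 //=; try lia.
    exists (u1 + (u2 + u3)), q3; split.
    * exact: ExecSeq y1 (ExecSeq y2 y3).
    * split.
      - apply: keeps_trans K' _; apply: keeps_trans (keeps_le _ Q1) _; first by lia.
        by apply: keeps_trans Q2 (keeps_le _ Q3).
      - by rewrite G3 ?w2 /= ?E1 ?w1 ?SE //; lia.
      - by rewrite w3 /= E2 addn1.
      - by rewrite G3 ?G2 ?Q1.1 //; lia.
    * lia.
  + move=> k kn; apply: (@bitlen_up _ b.+1); last by have := abits_ge b e; lia.
    by rewrite expnS; lia.
  exists (t0 + (t1 + (t2 + t3))), r3; split.
  + exact: ExecSeq x0 (ExecSeq x1 (ExecSeq x2 x3)).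
  + have nL : n <= L := limL l.
    apply: (@leq_trans (n * ((acost L e + 3) * U) + 4 * U)); first by rewrite /U in t3U *; lia.
    have : n * ((acost L e + 3) * U) <= L * ((acost L e + 3) * U) by rewrite leq_mul2r nL orbT.
    lia.
  + by rewrite v3.
  + exact: K3.
Qed.

Lemma fbits_ge c : b + 3 <= fbits b c.
Proof. by elim: c => /= [a e1 e2|*|*]; [have := abits_ge b e1 |..]; lia. Qed.

Lemma fcomp_spec c : forall s env ctx d r,
  bounded b L s -> safe b L env c s ->
  small b env -> holds_at ctx d env s r -> d + fbits b c <= w ->
  exists t r', [/\ exec (fcomp ctx d c) r t r', t <= fcost L c * U,
    forall a i, r' (bump TMP a) i = frun env c s a i
    & forall i, i < d -> r' TMP i = r TMP i].
Proof.
elim: c => [a e1 e2|c1 IH1 c2 IH2|l c IH] s env ctx d r bs sc eb H /= dw.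
- have [|t1 [r1 [x1 t1U v1 K1]]] := acomp_spec (e := e1) bs eb H; first by lia.
  have H1 := holds_le (leqnSn d) (holds_keeps H K1).
  have [|t2 [r2 [x2 t2U v2 K2]]] := acomp_spec (e := e2) bs eb H1.
    by have := abits_ge b e1; lia.
  have v1' : r2 TMP d = aval s env e1 by rewrite K2.1.
  have vb1 : bitlen (aval s env e1) <= w.+1.
    by apply: bitlen_up (aval_lt e1 bs.1 eb) _; lia.
  have vb2 : bitlen (aval s env e2) <= w.+1.
    by apply: bitlen_up (aval_lt e2 bs.1 eb) _; lia.
  have db : bitlen d <= w.+1 by apply: bitlen_id; lia.
  have db' : bitlen d.+1 <= w.+1 by apply: bitlen_id; have := abits_ge b e1; lia.
  exists (t1 + (t2 + (eval_time r2 (tmp d) + eval_time r2 (tmp d.+1)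
    + bitlen (eval r2 (tmp d)) + bitlen (eval r2 (tmp d.+1))))).
  eexists; split.
  + exact: ExecSeq x1 (ExecSeq x2 (ExecWrite _ _ _ _)).
  + by rewrite /= v1' v2 /U; rewrite /U in t1U t2U; lia.
  + have [A _ _] := holds_keeps H1 K2.
    move=> a' i; rewrite /= /update v1' v2 A.
    by rewrite (inj_eq (can_inj (@bumpK TMP))).
  + move=> i id; rewrite update_array 1?eq_sym ?bumpTMP // K2.1 ?K1.1 //.
    exact: ltnW.
- case: sc => s1 s2.
  have [|t1 [r1 [x1 t1U A1 K1]]] := IH1 _ _ _ _ _ bs s1 eb H; first by lia.
  have H1 : holds_at ctx d env (frun env c1 s) r1.
    by case: H => A B C; split=> // k; rewrite K1.
  have bs1 := safe_bounded bs s1.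
  have [|t2 [r2 [x2 t2U A2 K2]]] := IH2 _ _ _ _ _ bs1 s2 eb H1; first by lia.
  exists (t1 + t2), r2; split=> //; [exact: ExecSeq x1 x2 | lia |].
  by move=> i id; rewrite K2 ?K1.
- have fg := fbits_ge c.
  have db : bitlen d <= w.+1 by apply: bitlen_id; lia.
  have db1 : bitlen d.+1 <= w.+1 by apply: bitlen_id; lia.
  have zb : bitlen 0 <= w.+1 by apply: bitlen_id.
  have ob : bitlen 1 <= w.+1 by apply: bitlen_id; lia.
  have lb : bitlen l <= w.+1 by apply: bitlen_id; lia.
  pose n := s LIM l; pose S k := iteri k (fun i => frun (i :: env) c) s.
  have nb : n < 2 ^ b by apply: bs.1.
  have nb' : bitlen n <= w.+1 by apply: bitlen_up nb _; lia.
  (* The bounds hold at the start of every iteration, as the induction hypothesis for the body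
     requires. *)
  have bS k : k <= n -> bounded b L (S k).
    elim: k => [|k IHk] //= kn.
    by apply: safe_bounded (sc _ _) => //; apply: IHk; apply: ltnW.
  have [||/=|t1 [r1 [x1 t1U v1 K1 F1]]] := @set_tmp_spec d (Const 0) r;
    rewrite //=; try lia.
  have [A1 _ _] := holds_keeps H K1.
  have [|/=|/=|t2 [r2 [x2 t2U v2 K2 F2]]] :=
    @set_tmp_spec d.+1 (Read (bump TMP LIM) (Const l)) r1;
    rewrite /= ?A1 //=; try (by rewrite -/n; lia).
  have K2' : keeps d r r2 by apply: keeps_trans K1 (keeps_le _ K2); lia.
  pose P k r' := [/\ forall a i, r' (bump TMP a) i = S k a i,
    forall i, i < d -> r' TMP i = r TMP i, r' TMP d = k & r' TMP d.+1 = n].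
  have P0 : P 0 r2.
    split=> //.
    + by have [] := holds_keeps H K2'.
    + by case: K2'.
    + by rewrite F2 ?v1 //; lia.
    + by rewrite v2 /= A1.
  have [|||t3 [r3 [x3 [A3 K3 _ _] t3U]]] := @while_up d d.+1
    (Seq (fcomp (d :: ctx) d.+2 c) (set_tmp d (next d)))
    n P ((fcost L c + 1) * U) w.+1 _ _ db db1 ob _ r2 P0.
  + by move=> k r' [].
  + move=> k r' kn [A' K' vd vd1].
    have kb : k < 2 ^ b by apply: ltn_trans nb.
    have H' : holds_at (d :: ctx) d.+2 (k :: env) (S k) r'.
      have : holds_at ctx d.+2 env (S k) r'.
        case: H => A B C; split=> [//|k'|k']; first by rewrite K'.
        by apply: leq_trans (C k') _; lia.
      by move/(holds_cons (leqnSn d.+1)); rewrite vd.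
    have [|u1 [q1 [y1 u1U B1 Q1]]] :=
      IH _ _ _ d.+2 r' (bS _ (ltnW kn)) (sc _ kn) (small_cons kb eb) H'; first by lia.
    have E1 : q1 TMP d = k by rewrite Q1 //; lia.
    have kb' : bitlen k.+1 <= w.+1.
      by apply: (@bitlen_up _ b); [exact: leq_ltn_trans nb | by lia].
    have kb2 : bitlen k <= w.+1 by apply: (@bitlen_up _ b) => //; lia.
    have [|/=|/=|u3 [q3 [y3 u3U w3 Q3 G3]]] := @set_tmp_spec d (next d) q1;
      rewrite /= ?E1 ?addn1 //=; try lia.
    exists (u1 + u3), q3; split.
    * exact: ExecSeq y1 y3.
    * split.
      - by move=> a i; rewrite Q3.2 ?bumpTMP // B1.
      - by move=> i id; rewrite Q3.1 // Q1 ?K' //; lia.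
      - by rewrite w3 /= E1 addn1.
      - by rewrite G3 ?Q1 //; lia.
    * lia.
  + move=> k kn; apply: (@bitlen_up _ b.+1); last by lia.
    by rewrite expnS; lia.
  exists (t1 + (t2 + t3)), r3; split=> //.
    exact: ExecSeq x1 (ExecSeq x2 x3).
  have nL : n <= L := bs.2 l.
    apply: (@leq_trans (n * ((fcost L c + 2) * U) + 3 * U)); first by rewrite /U in t3U *; lia.
    have : n * ((fcost L c + 2) * U) <= L * ((fcost L c + 2) * U) by rewrite leq_mul2r nL orbT.
    lia.
Qed.

End Compile.

(** * Polynomial running time of compiled programs *)

Definition poly_bounded (f : nat -> nat) : Prop :=
  exists p : {poly nat}, forall x, f x <= (p.[x])%R.

Lemma poly_bounded_const n : poly_bounded (fun => n).
Proof. by exists (n%:P)%R => x; rewrite hornerC. Qed.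

Lemma poly_bounded_id : poly_bounded id.
Proof. by exists ('X)%R => x; rewrite hornerX. Qed.

Lemma poly_bounded_add f g :
  poly_bounded f -> poly_bounded g -> poly_bounded (fun x => f x + g x).
Proof.
by move=> [p fp] [q gq]; exists (p + q)%R => x; rewrite hornerD leq_add.
Qed.

Lemma poly_bounded_mul f g :
  poly_bounded f -> poly_bounded g -> poly_bounded (fun x => f x * g x).
Proof.
by move=> [p fp] [q gq]; exists (p * q)%R => x; rewrite hornerM leq_mul.
Qed.

Lemma poly_bounded_abits f e :
  poly_bounded f -> poly_bounded (fun x => abits (f x) e).
Proof.
move=> pf; elim: e => [n|k|a e IH|o e1 IH1 e2 IH2|l e IH] /=;
  by repeat (exact: poly_bounded_const || assumption || apply: poly_bounded_add).
Qed.

Lemma poly_bounded_fbits f c :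
  poly_bounded f -> poly_bounded (fun x => fbits (f x) c).
Proof.
move=> pf; elim: c => [a e1 e2|c1 IH1 c2 IH2|l c IH] /=;
  by repeat (exact: poly_bounded_const || assumption
             || exact: poly_bounded_abits || apply: poly_bounded_add).
Qed.

Lemma poly_bounded_acost f e :
  poly_bounded f -> poly_bounded (fun x => acost (f x) e).
Proof.
move=> pf; elim: e => [n|k|a e IH|o e1 IH1 e2 IH2|l e IH] /=;
  by repeat (exact: poly_bounded_const || assumption
             || apply: poly_bounded_add || apply: poly_bounded_mul).
Qed.

Lemma poly_bounded_fcost f c :
  poly_bounded f -> poly_bounded (fun x => fcost (f x) c).
Proof.
move=> pf; elim: c => [a e1 e2|c1 IH1 c2 IH2|l c IH] /=;
  by repeat (exact: poly_bounded_const || assumption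
             || exact: poly_bounded_acost || apply: poly_bounded_add
             || apply: poly_bounded_mul).
Qed.

(** For a fixed program [fcost] and [fbits] are polynomials in [L] and [b], so bounds on the run of
    the loop program suffice. Compilation starts at depth 1, which reserves temporary 0 for the
    constant 0. *)
Lemma compile_poly_time c (b L : nat -> nat) : poly_bounded b -> poly_bounded L ->
  exists p : {poly nat}, forall x s, bounded (b x) (L x) s ->
    safe (b x) (L x) [::] c s -> (forall a i, a != 0 -> s a i = 0) ->
    exists t r, [/\ exec (fcomp [::] 1 c) s t r, t <= (p.[x])%R
      & forall a i, r (bump TMP a) i = frun [::] c s a i].
Proof.
move=> pb pL.
have [p fp] : poly_bounded
    (fun x => fcost (L x) c * (20 * (1 + fbits (b x) c + 1))).
  by repeat (exact: poly_bounded_const || exact: poly_bounded_fcost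
    || exact: poly_bounded_fbits || apply: poly_bounded_mul || apply: poly_bounded_add).
exists p => x s bs sc s0.
have [||t [r [xr tp A _]]] := @fcomp_spec (b x) (L x) (1 + fbits (b x) c) c
  s [::] [::] 1 s bs sc _ _ (leqnn _).
- by move=> k; rewrite nth_nil expn_gt0.
- split=> [a i|k|k]; rewrite ?nth_nil //; last by rewrite s0.
  (* [bump TMP] fixes array 0, the only one with nonzero cells initially. *)
  by case: a => [|a] //; rewrite !s0 // /bump; case: ltnP.
- exists t, r; split=> //; apply: leq_trans tp _.
  by apply: leq_trans (fp x); rewrite addn1.
Qed.

(** * Hoare-style rules that also track the size bounds *)

Definition fspec b L env c (s : store) (Q : store -> Prop) : Prop :=
  safe b L env c s /\ Q (frun env c s).

Lemma fspec_seq b L env c1 c2 s Q :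
  fspec b L env c1 s (fun s' => fspec b L env c2 s' Q) ->
  fspec b L env (FSeq c1 c2) s Q.
Proof. by case=> s1 [s2 q]; split. Qed.

Lemma fspec_for b L env l c s (P : nat -> store -> Prop) :
  P 0 s ->
  (forall i s', i < s LIM l -> P i s' -> fspec b L (i :: env) c s' (P i.+1)) ->
  fspec b L env (FFor l c) s (P (s LIM l)).
Proof.
move=> P0 PS.
have H k : k <= s LIM l -> P k (iteri k (fun i => frun (i :: env) c) s).
  elim: k => [|k IHk] //= lk.
  by case: (PS _ _ lk (IHk (ltnW lk))).
split; last exact: H.
by move=> i il; case: (PS _ _ il (H _ (ltnW il))).
Qed.

Lemma fspec_impl b L env c s (Q Q' : store -> Prop) :
  (forall s', Q s' -> Q' s') -> fspec b L env c s Q -> fspec b L env c s Q'.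
Proof. by move=> QQ [sc q]; split=> //; apply: QQ. Qed.

(** * Local ratio with reverse deletion *)

Section Covering.

Variables (N m : nat) (bd cap u price : nat -> nat).

(** Intervals are half-open. This definition and the next ones use only the operations of the
    machine, so that the expressions of the program evaluate to them by computation. *)
Definition act (I t : nat) : nat := (bd (2 * I) <= t) * (t + 1 <= bd (2 * I + 1)).

Definition cov (z : nat -> nat) (t : nat) : nat :=
  \sum_(I < N) act I t * (cap I * z I).

Definition dem (t : nat) : nat := \sum_(I < N) (m <= I) * act I t.

Definition exc (x : nat -> nat) (q : nat) : nat := dem (bd q) - cov x (bd q).

(** The nested truncated subtraction is the minimum of [cap I] and the deficit; [x I == 0] marks the
    items not yet chosen. *)
Definition weight (x : nat -> nat) (q I : nat) : nat :=
  act I (bd q) * (x I == 0) * (cap I - (cap I - exc x q)).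

Definition feas (z : nat -> nat) : Prop :=
  forall q, q < 2 * N -> dem (bd q) <= cov z (bd q).

Definition blend (st : nat -> nat) (j : nat) (z : nat -> nat) (I : nat) : nat :=
  if I \in mkseq st j then u I else z I.

(** This is what reverse deletion guarantees for round [j]: even with the items of the earlier
    rounds present in full, no copy of a later item can be spared. *)
Definition minimal (st : nat -> nat) (j : nat) (z : nat -> nat) : Prop :=
  forall I, I < N -> I \notin mkseq st j -> 0 < z I ->
    exists q, [/\ q < 2 * N, act I (bd q) = 1
      & cov (blend st j z) (bd q) < dem (bd q) + cap I].

Definition dot (r z : nat -> nat) : nat := \sum_(I < N) r I * z I.

Lemma actE I t : act I t = (bd (2 * I) <= t < bd (2 * I + 1)) :> nat.
Proof. by rewrite /act addn1 mulnb. Qed.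

Lemma act1P I t : act I t = 1 <-> bd (2 * I) <= t < bd (2 * I + 1).
Proof. by rewrite actE; case: (_ <= t < _). Qed.

Lemma cov_le y z t : (forall I, I < N -> y I <= z I) -> cov y t <= cov z t.
Proof. by move=> yz; apply: leq_sum => I _; rewrite !leq_mul // yz. Qed.

Lemma eq_cov y z t : (forall I, I < N -> y I = z I) -> cov y t = cov z t.
Proof. by move=> yz; apply: eq_bigr => I _; rewrite yz. Qed.

Lemma feas_exc x : feas x <-> forall q, q < 2 * N -> exc x q = 0.
Proof.
by split=> H q qN; have := H q qN; rewrite /exc => /eqP; rewrite ?subn_eq0 // => /eqP; lia.
Qed.

(* Between two consecutive endpoints the set of active items is constant. *)
Lemma feas_everywhere z : feas z -> forall t, dem t <= cov z t.
Proof.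
move=> fz t.
case: (pickP (fun q : 'I_(2 * N) => bd q <= t)) => [q0 q0t | none].
  case: (@arg_maxnP _ q0 (fun q : 'I_(2 * N) => bd q <= t) (fun q => bd q) q0t) => q qt qmax.
  have E I : I < N -> act I t = act I (bd q).
    move=> IN; rewrite !actE; congr nat_of_bool.
    have l1 : 2 * I < 2 * N by lia.
    have l2 : 2 * I + 1 < 2 * N by lia.
    have := qmax (Ordinal l1); have := qmax (Ordinal l2) => /=; lia.
  have -> : dem t = dem (bd q) by apply: eq_bigr => I _; rewrite E.
  have -> : cov z t = cov z (bd q) by apply: eq_bigr => I _; rewrite E.
  exact: fz.
(* Before the first endpoint no item is active, so there is no demand. *)
rewrite /dem big1 // => I _; rewrite actE.
have l1 : 2 * I < 2 * N by have := ltn_ord I; lia.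
by have := none (Ordinal l1) => /= ->; rewrite muln0.
Qed.

(** If some item in use has capacity at least [D], it alone still contributes [D] after truncation;
    otherwise truncation changes no item in use. *)
Lemma sum_min_ge (P : pred 'I_N) (a z : 'I_N -> nat) D :
  D <= \sum_(I | P I) a I * z I ->
  D <= \sum_(I | P I) (a I - (a I - D)) * z I.
Proof.
move=> le; case: (pickP (fun I => [&& P I, D <= a I & 0 < z I])) => [I | none].
  case/and3P=> PI Da z0; rewrite (bigD1 I) //=.
  apply: leq_trans (leq_addr _ _).
  by rewrite subKn // leq_pmulr.
rewrite (eq_bigr (fun I => a I * z I)) // => I PI.
have := none I; rewrite PI /=; case: (leqP D (a I)) => Da /=.
  by case: (z I) => // _; rewrite !muln0.
by move=> _; congr (_ * _); lia.
Qed.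

Lemma weight_dot_ge x q z :
  (forall I, I < N -> x I = 0 \/ x I = u I) ->
  (forall I, I < N -> z I <= u I) -> q < 2 * N -> feas z ->
  exc x q <= dot (weight x q) z.
Proof.
move=> xu zu qN fz; have fq := fz q qN; rewrite /exc in fq *.
pose P (I : 'I_N) := (act I (bd q) == 1) && (x I == 0).
set D := dem _ - _.
have H : D <= \sum_(I | P I) cap I * z I.
  rewrite leq_subLR; apply: leq_trans fq _.
  rewrite /cov [X in _ <= _ + X]big_mkcond -big_split; apply: leq_sum => I _ /=.
  rewrite /P actE; case: (_ <= _ < _) => //=; case: eqP => xI /=; first lia.
  have [|->] := xu I (ltn_ord I); first by move/xI.
  by rewrite !mul1n addn0 leq_mul2l zu ?orbT.
apply: leq_trans (sum_min_ge H) _.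
rewrite /dot big_mkcond; apply: leq_sum => I _ /=.
rewrite /P /weight -/(exc x q) -/D actE; case: (_ <= _ < _) => //=.
by case: eqP => //= _; rewrite !mul1n.
Qed.

(** Without one copy of [I0] the sum of the [a I] is less than [D], and [b I <= a I]; putting the
    copy back adds at most [b I0 <= D]. *)
Lemma side_le (P : pred 'I_N) (a b z : 'I_N -> nat) D I0 :
  P I0 -> 0 < z I0 -> (forall I, P I -> b I <= a I /\ b I <= D) ->
  \sum_(I | P I) a I * z I < D + a I0 -> \sum_(I | P I) b I * z I <= 2 * D.
Proof.
move=> P0 z0 bP; rewrite (bigD1 I0) //= => lt; rewrite (bigD1 I0) //=.
have : \sum_(I | P I && (I != I0)) b I * z I
     <= \sum_(I | P I && (I != I0)) a I * z I.
  by apply: leq_sum => I /andP[PI _]; rewrite leq_mul2r (bP I PI).1 orbT.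
have [ba bD] := bP _ P0; case: (z I0) z0 lt => // k _ lt.
have : b I0 * k <= a I0 * k by rewrite leq_mul2r ba orbT.
by move: lt; rewrite !mulnS; move: (\sum_(_ | _) _) (\sum_(_ | _) _); lia.
Qed.

(* Items essential at a time left of the most deficient time [bd q0] are all
   active at the rightmost of those times, where the slack is less than one
   item; symmetrically on the right. *)
Lemma weight_dot_le x q0 st k z :
  (forall I, I < N -> x I = if I \in mkseq st k then u I else 0) ->
  (forall I, I < N -> 0 < u I) ->
  (forall q, q < 2 * N -> exc x q <= exc x q0) ->
  minimal st k z -> dot (weight x q0) z <= 4 * exc x q0.
Proof.
move=> xE u0 qmax mz; set D := exc x q0; set t0 := bd q0.
pose crit (I : 'I_N) (q : 'I_(2 * N)) :=
  (act I (bd q) == 1) && (cov (blend st k z) (bd q) < dem (bd q) + cap I).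
pose tq I := if [pick q | crit I q] is Some q then bd q else 0.
pose U (I : 'I_N) := [&& act I t0 == 1, x I == 0 & 0 < z I].
have Uz I : U I -> (I : nat) \notin mkseq st k.
  case/and3P=> _ /eqP; rewrite xE //; case: ifP => // _ uI.
  by have := u0 I (ltn_ord I); rewrite uI.
have UP I : U I -> act I (tq I) = 1 /\
    cov (blend st k z) (tq I) < cov x (tq I) + D + cap I.
  move=> UI; have [_ _ z0] := and3P UI.
  rewrite /tq; case: pickP => [q | none].
    case/andP=> /eqP aq lt; split=> //; apply: leq_trans lt _.
    (* Maximality of [D]: at every endpoint the demand exceeds the coverage by [x] by at most
       [D]. *)
    by have := qmax q (ltn_ord q); rewrite /exc -/(exc x q0) -/D; lia.
  have [q [qN aq lt]] := mz I (ltn_ord I) (Uz I UI) z0.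
  by have := none (Ordinal qN); rewrite /crit /= aq lt.
have side (P : pred 'I_N) I0 : P I0 -> (forall I, P I -> U I) ->
    (forall I, P I -> act I (tq I0) = 1) ->
    \sum_(I | P I) weight x q0 I * z I <= 2 * D.
  move=> P0 PU Pt.
  apply: (@side_le P (fun I => cap I) (fun I => weight x q0 I) (fun I => z I) D I0) => //.
  - by case/and3P: (PU _ P0).
  - move=> I /PU /and3P[/eqP aI xI _].
    by rewrite /weight -/t0 -/D aI xI !mul1n; split; lia.
  have [_ lt] := UP _ (PU _ P0).
  (* [blend] contains the chosen items in full and those of [P] as often as [z] does; the two groups
     are disjoint, so their contributions add up. *)
  suff : cov x (tq I0) + \sum_(I | P I) cap I * z I <= cov (blend st k z) (tq I0) by lia.
  rewrite /cov [X in _ + X <= _]big_mkcond -big_split; apply: leq_sum => I _ /=.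
  case: ifP => PI; last first.
    by rewrite addn0 /blend xE // !leq_mul //; case: ifP.
  rewrite Pt // !mul1n /blend (negbTE (Uz _ (PU _ PI))).
  by case/and3P: (PU _ PI) => _ /eqP -> _; rewrite muln0.
have side0 (P : pred 'I_N) (f : 'I_N -> nat) : (forall I, P I -> U I) ->
    (forall I J, P I -> P J -> f J <= f I -> act J (tq I) = 1) ->
    \sum_(I | P I) weight x q0 I * z I <= 2 * D.
  move=> PU Pf; case: (pickP P) => [I0 P0 | none]; last by rewrite big_pred0.
  case: (@arg_maxnP _ I0 P f P0) => I1 P1 max1.
  by apply: (side P I1) => // I PI; apply: Pf => //; apply: max1.
have L : \sum_(I | U I && (tq I <= t0)) weight x q0 I * z I <= 2 * D.
  apply: (side0 _ tq) => [I /andP[] // | I J /andP[UI It] /andP[UJ Jt] le].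
  have [/act1P aJ _] := UP _ UJ; case/and3P: UJ => /eqP/act1P a0 _ _.
  by apply/act1P; lia.
have R : \sum_(I | U I && ~~ (tq I <= t0)) weight x q0 I * z I <= 2 * D.
  (* Subtraction from a common upper bound of all [tq I] turns the leftmost critical time into a
     maximum. *)
  apply: (side0 _ (fun I => \sum_J tq J - tq I)) =>
      [I /andP[] // | I J /andP[UI It] /andP[UJ Jt] le].
  have [/act1P aJ _] := UP _ UJ; case/and3P: UJ => /eqP/act1P a0 _ _.
  have lI : tq I <= \sum_J tq J by rewrite (bigD1 I) //= leq_addr.
  move: le lI => /=; set S := \sum_J tq J; clearbody S => le lI.
  by apply/act1P; lia.
suff -> : dot (weight x q0) z = \sum_(I | U I) weight x q0 I * z I.
  rewrite (bigID (fun I => tq I <= t0)) /= (_ : 4 * D = 2 * D + 2 * D).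
    exact: leq_add.
  by rewrite -mulnDl.
rewrite /dot [RHS]big_mkcond; apply: eq_bigr => I _; rewrite /U /weight -/t0 actE.
case: (_ <= _ < _) => //=; case: (x I == 0) => //=.
by case: (z I) => //=; rewrite muln0.
Qed.

(** The item minimizes [r I / W I]. Ratios are compared by cross multiplication, under which a zero
    weight acts as an infinite ratio; the minimum is updated item by item. *)
Lemma best_ratio (r W : nat -> nat) :
  (exists2 I, I < N & 0 < W I) ->
  exists c, [/\ c < N, 0 < W c & forall I, I < N -> r c * W I <= r I * W c].
Proof.
move=> [I0 I0N W0].
suff H K : (forall I, I < K -> W I = 0) \/
    exists c, [/\ c < K, 0 < W c & forall I, I < K -> r c * W I <= r I * W c].
  by case: (H N) => // Z; rewrite Z in W0.
elim: K => [|K IH]; first by left.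
case: (posnP (W K)) => WK.
  case: IH => [Z | [c [cK Wc H]]].
    by left=> I; rewrite ltnS leq_eqVlt => /orP[/eqP -> // | /Z].
  right; exists c; split=> //; first exact: leqW.
  move=> I; rewrite ltnS leq_eqVlt => /orP[/eqP -> | /H //].
  by rewrite WK muln0.
right; case: IH => [Z | [c [cK Wc H]]].
  exists K; split=> // I; rewrite ltnS leq_eqVlt => /orP[/eqP -> // | /Z ->].
  by rewrite muln0.
case: (leqP (r c * W K) (r K * W c)) => cmp.
  exists c; split=> //; first exact: leqW.
  by move=> I; rewrite ltnS leq_eqVlt => /orP[/eqP -> | /H].
exists K; split=> // I; rewrite ltnS leq_eqVlt => /orP[/eqP -> // | /H le].
rewrite -(leq_pmul2r Wc).
apply: (@leq_trans (r c * W K * W I)).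
  by rewrite mulnAC leq_mul2r (ltnW cmp) orbT.
by rewrite mulnAC [leqRHS]mulnAC leq_mul2r le orbT.
Qed.

(** * Invariant of the charging phase *)

Hypothesis cap_job : forall I, m <= I -> I < N -> cap I = 1.
Hypothesis u_job : forall I, m <= I -> I < N -> u I = 1.
Hypothesis u_gt0 : forall I, I < N -> 0 < u I.
Hypothesis u_N : u N = 0.

(* [Y] is the value of the dual solution; [sigma] is the product of the factors by
   which the residual prices [r] have been multiplied to keep them integral. *)
Record descent (k : nat) (r x st : nat -> nat) : Prop := Descent {
  descent_dual : exists sigma Y, [/\ 0 < sigma,
    forall z, (forall I, I < N -> z I <= u I) -> feas z ->
      Y + dot r z <= sigma * dot price z
    & forall z, (forall j, j < k -> minimal st j z) ->
      sigma * dot price z <= 4 * Y + dot r z];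
  descent_x : forall I, I < N -> x I = if I \in mkseq st k then u I else 0;
  descent_r : forall I, I < N -> I \in mkseq st k -> r I = 0;
  descent_fresh : forall j, j < k -> st j < N -> st j \notin mkseq st j;
  descent_progress : feas x \/ forall j, j < k -> st j < N;
  descent_N : x N = 0 }.

(** Each job's unit item pays for that job's own demand: all jobs are rejected. *)
Lemma feas_all x :
  (forall I, m <= I -> I < N -> 0 < x I) -> feas x.
Proof.
move=> x0 q _; apply: leq_sum => I _; case: (leqP m I) => // mI.
by rewrite cap_job // !mul1n leq_pmulr // x0.
Qed.

Lemma descent0 (r x st : nat -> nat) :
  (forall I, I < N -> r I = price I) -> (forall I, I <= N -> x I = 0) ->
  descent 0 r x st.
Proof.
move=> rE x0; split=> //.
- exists 1, 0; have E z : dot r z = dot price z by apply: eq_bigr => I _; rewrite rE.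
  by split=> // z _; rewrite ?E mul1n.
- by move=> I IN; rewrite x0 // ltnW.
- by right.
- exact: x0.
Qed.

Definition chosen (r W : nat -> nat) (I : nat) : Prop :=
  0 < W I /\ forall J, J < N -> r I * W J <= r J * W I.

(** With a charged item [c], scaling by [W c] splits the old residual price exactly:
    [r I * W c = r' I + r c * W I]. Hence the dual value becomes [Y * W c + r c * exc x q0];
    [weight_dot_ge] preserves the lower bound and [weight_dot_le] the upper one. *)
Lemma descentS k r x st q0 W c r' x' st' :
  descent k r x st -> k < N -> q0 < 2 * N ->
  (forall q, q < 2 * N -> exc x q <= exc x q0) ->
  (forall I, I < N -> W I = weight x q0 I) -> W N = 0 ->
  (c < N /\ chosen r W c) \/ (c = N /\ forall I, I < N -> ~ chosen r W I) ->
  (forall I, I < N -> r' I = r I * (W c + (W c == 0)) - r c * W I) ->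
  (forall I, I <= N -> x' I = if I == c then u c else x I) ->
  (forall j, j <= k -> st' j = if j == k then c else st j) ->
  descent k.+1 r' x' st'.
Proof.
move=> [[sg [Y [sg0 lower upper]]] xE rE fresh progress xN] kN qN qmax WE WN cP r'E x'E st'E.
have pre j : j <= k -> mkseq st' j = mkseq st j.
  move=> jk; apply/eq_in_map => i; rewrite mem_iota => /andP[_ ij].
  by rewrite st'E; [case: eqP => // e | ]; lia.
have preS : mkseq st' k.+1 = rcons (mkseq st k) c.
  by rewrite mkseqS pre // st'E // eqxx.
have xu I : I < N -> x I = 0 \/ x I = u I.
  by move=> IN; rewrite xE //; case: ifP; [right | left].
have min_st z : (forall j, j < k.+1 -> minimal st' j z) ->
    forall j, j < k.+1 -> minimal st j z.
  by move=> H j jk; have := H j jk; rewrite /minimal /blend pre.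
have dotW z : dot W z = dot (weight x q0) z.
  by apply: eq_bigr => I _; rewrite WE.
(* If no item can be charged, the dummy index [N] is pushed: the factor is 1, all weights are 0 and
   nothing changes on real items. *)
case: cP => [[cN [Wc cbest]] | [cE none]]; last first.
  subst c; rewrite WN in r'E.
  have r'r I : I < N -> r' I = r I.
    by move=> IN; rewrite r'E // add0n eqxx muln1 (_ : _ * W I = 0) ?subn0 //;
    case: (posnP (W I)) => [-> | WI]; rewrite ?muln0 //;
    have [c [cN Wc cb]] := best_ratio r (ex_intro2 _ _ I IN WI); case: (none c cN).
  have x'x I : I < N -> x' I = x I.
    by move=> IN; rewrite x'E ?(ltnW IN) // ltn_eqF.
  (* Were the maximal deficit positive, every unchosen job item active at [bd q0] would have
     positive weight. So all of them are chosen, and they meet the demand there, which is a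
     contradiction. *)
  have fx : feas x.
    apply/feas_exc => q qq; apply/eqP; rewrite -leqn0.
    apply: leq_trans (qmax q qq) _; rewrite leqNgt; apply/negP => D0.
    have W0 I : I < N -> W I = 0.
      move=> IN; case: (posnP (W I)) => // WI.
      by have [c [cN Wc cb]] := best_ratio r (ex_intro2 _ _ I IN WI); case: (none c cN).
    suff : dem (bd q0) <= cov x (bd q0) by move: D0; rewrite /exc; lia.
    apply: leq_sum => I _; case: (leqP m I) => // mI.
    have := W0 I (ltn_ord I); rewrite WE // /weight cap_job // actE.
    case: (_ <= _ < _) => //=; case: (posnP (x I)) => x0 /=; last by lia.
    by move: D0; lia.
  have E I : I < N -> (I \in mkseq st' k.+1) = (I \in mkseq st k).
    by move=> IN; rewrite preS mem_rcons inE ltn_eqF.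
  split.
  - exists sg, Y; have D z : dot r' z = dot r z by apply: eq_bigr => I _; rewrite r'r.
    split=> // z H; rewrite D; first exact: lower.
    by apply: upper => j jk; apply: (min_st z H); apply: leqW.
  - by move=> I IN; rewrite x'x // E // xE.
  - by move=> I IN; rewrite E // r'r //; apply: rE.
  - move=> j; rewrite ltnS leq_eqVlt => /orP[/eqP -> | jk].
      by rewrite st'E // eqxx ltnn.
    by rewrite pre ?(ltnW jk) // st'E ?(ltnW jk) // ltn_eqF //; apply: fresh.
  - by left=> q qq; rewrite (@eq_cov x' x) //; apply: fx.
  - by rewrite x'E // eqxx u_N.
rewrite (gtn_eqF Wc) addn0 in r'E.
have rW I : I < N -> r I * W c = r' I + r c * W I.
  by move=> IN; rewrite r'E // subnK // cbest.
have rWz z : dot r z * W c = dot r' z + r c * dot W z.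
  rewrite /dot big_distrl big_distrr -big_split; apply: eq_bigr => I _ /=.
  by rewrite mulnAC rW // mulnDl mulnA.
have xc : x c = 0.
  by have := Wc; rewrite WE // /weight; case: eqP => //; rewrite muln0.
have c_new : c \notin mkseq st k.
  by apply/negP => ci; have := xE c cN; rewrite ci xc => /esym uc; have := u_gt0 cN; rewrite uc.
split.
- exists (sg * W c), (Y * W c + r c * exc x q0); split=> [|z zu fz|z mz].
  + by rewrite muln_gt0 sg0.
  + have := lower z zu fz; rewrite -(leq_pmul2r Wc) mulnDl rWz dotW.
    have := leq_mul (leqnn (r c)) (weight_dot_ge xu zu qN fz).
    by rewrite mulnAC; move: (dot _ _) (dot _ _) (dot _ _) => d1 d2 d3; nia.
  + have := upper z (fun j jk => min_st z mz j (leqW jk)).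
    rewrite -(leq_pmul2r Wc) mulnDl rWz dotW mulnAC.
    have := leq_mul (leqnn (r c)) (weight_dot_le xE u_gt0 qmax (min_st z mz k (leqnn _))).
    by move: (dot _ _) (dot _ _) (dot _ _) => d1 d2 d3; nia.
- move=> I IN; rewrite x'E ?(ltnW IN) // preS mem_rcons inE.
  by case: eqP => [-> | _] //=; rewrite xE.
- move=> I IN; rewrite preS mem_rcons inE r'E // => /orP[/eqP -> | Ik].
    by rewrite subnn.
  by rewrite rE // mul0n.
- move=> j; rewrite ltnS leq_eqVlt => /orP[/eqP -> | jk].
    by rewrite st'E // eqxx pre.
  by rewrite pre ?(ltnW jk) // st'E ?(ltnW jk) // ltn_eqF //; apply: fresh.
- case: progress => [fx | lt]; [left | right] => [q qq | j].
    apply: leq_trans (fx q qq) (cov_le _ _) => I IN.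
    by rewrite x'E ?(ltnW IN) //; case: eqP => [-> | //]; rewrite xc.
  rewrite ltnS leq_eqVlt => /orP[/eqP -> | jk]; first by rewrite st'E // eqxx.
  by rewrite st'E ?(ltnW jk) // ltn_eqF //; apply: lt.
- by rewrite x'E // gtn_eqF.
Qed.

(** Pigeonhole: if a real item was pushed in each of the [N] rounds, these items are distinct and
    exhaust all items, in particular all job items. *)
Lemma descent_feas r x st : descent N r x st -> feas x.
Proof.
move=> [_ xE _ fresh [//|lt] _]; apply: feas_all => I mI IN.
have uq j : j <= N -> uniq (mkseq st j).
  elim: j => [//|j IH] jN; rewrite mkseqS rcons_uniq IH ?(ltnW jN) // andbT.
  by apply: fresh => //; apply: lt.
have sub : {subset mkseq st N <= iota 0 N}.
  move=> y /mapP[j]; rewrite mem_iota => /andP[_ jN] ->.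
  by rewrite mem_iota /= add0n lt.
have [] := uniq_min_size (uq N (leqnn N)) sub _; rewrite ?size_mkseq ?size_iota // => _ E.
by rewrite xE // E mem_iota /= add0n IN u_job.
Qed.

(** * Reverse deletion *)

Record pruned (st : nat -> nat) (j : nat) (x : nat -> nat) : Prop := Pruned {
  pruned_feas : feas x;
  pruned_le : forall I, I < N -> x I <= u I;
  pruned_full : forall I, I < N -> I \in mkseq st j -> x I = u I;
  pruned_out : forall I, I < N -> I \notin mkseq st N -> x I = 0;
  pruned_min : forall i, j <= i -> i <= N -> minimal st i x;
  pruned_N : x N = 0 }.

Lemma prunedN r x st : descent N r x st -> pruned st N x.
Proof.
move=> dx; have fx := descent_feas dx; case: dx => _ xE _ _ _ xN.
split=> //.
- by move=> I IN; rewrite xE //; case: ifP.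
- by move=> I IN IS; rewrite xE // IS.
- by move=> I IN IS; rewrite xE // (negbTE IS).
- move=> i iN iN'; have -> : i = N by apply/eqP; rewrite eqn_leq iN' iN.
  by move=> I IN IS; rewrite xE // (negbTE IS).
Qed.

(** When [x] is a cover containing [c], this says that dropping a copy of [c] would leave a deficit:
    an endpoint where [c] is inactive cannot be a witness. *)
Definition blocked (x : nat -> nat) (c : nat) : bool :=
  [exists q : 'I_(2 * N), cov x (bd q) < dem (bd q) + cap c * act c (bd q)].

(* [partial st j l x]: item [st j] has been tried [l] times. *)
Record partial (st : nat -> nat) (j l : nat) (x : nat -> nat) : Prop := Partial {
  partial_feas : feas x;
  partial_le : forall I, I < N -> x I <= u I;
  partial_full : forall I, I < N -> I \in mkseq st j -> x I = u I;
  partial_out : forall I, I < N -> I \notin mkseq st N -> x I = 0;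
  partial_min : forall i, j < i -> i <= N -> minimal st i x;
  partial_rest : forall I, I < N -> I \notin mkseq st j -> I != st j -> 0 < x I ->
    exists q, [/\ q < 2 * N, act I (bd q) = 1
      & cov x (bd q) < dem (bd q) + cap I];
  partial_try : blocked x (st j) \/ x (st j) <= u (st j) - l;
  partial_N : x N = 0 }.

(** While the items of the first [j] rounds are untouched, minimality can be read off the current
    cover itself. *)
Lemma blend_full st j x I : (forall I, I < N -> I \in mkseq st j -> x I = u I) ->
  I < N -> blend st j x I = x I.
Proof. by move=> xE IN; rewrite /blend; case: ifP => // IS; rewrite xE. Qed.

Lemma partial0 st j x : j < N -> st j <= N -> pruned st j.+1 x -> partial st j 0 x.
Proof.
move=> jN sj [fx xu xE xo xm xN]; split=> //.
- by move=> I IN IS; apply: xE => //; rewrite mkseqS mem_rcons inE IS orbT.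
- move=> I IN IS Ij x0; have [|q [qN aq lt]] := xm j.+1 (leqnn _) jN I IN _ x0.
    by rewrite mkseqS mem_rcons inE negb_or Ij.
  exists q; split=> //; rewrite -(@eq_cov (blend st j.+1 x)) // => J JN.
  exact: blend_full.
- right; rewrite subn0; case: (ltngtP (st j) N) sj => // [sN | ->] _; first exact: xu.
  by rewrite xN.
Qed.

(** Dropping copies only lowers coverage, so a time at which an item is essential stays such a
    time. *)
Lemma partialS st j l x x' : j < N -> st j <= N ->
  (st j < N -> st j \notin mkseq st j) ->
  partial st j l x ->
  (forall I, x' I = if I == st j then x I - ~~ blocked x (st j) else x I) ->
  partial st j l.+1 x'.
Proof.
move=> jN sj fresh [fx xu xE xo xm xr xt xN] x'E.
case bl: (blocked x (st j)) in x'E; rewrite /= in x'E.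
  have x'x I : x' I = x I by rewrite x'E subn0; case: eqP.
  have cE t : cov x' t = cov x t by apply: eq_cov.
  split.
  - by move=> q /fx; rewrite cE.
  - by move=> I IN; rewrite x'x xu.
  - by move=> I IN; rewrite x'x; apply: xE.
  - by move=> I IN; rewrite x'x; apply: xo.
  - move=> i ij iN I IN IS; rewrite x'x => x0.
    have [q [qN aq lt]] := xm i ij iN I IN IS x0; exists q; split=> //.
    by rewrite (@eq_cov _ (blend st i x)) // => J JN; rewrite /blend x'x.
  - move=> I IN IS Ij; rewrite x'x => x0.
    by have [q [qN aq lt]] := xr I IN IS Ij x0; exists q; rewrite cE.
  - left; case/existsP: bl => q lt; apply/existsP; exists q; by rewrite cE.
  - by rewrite x'x.
have le I : x' I <= x I by rewrite x'E; case: eqP => // _; apply: leq_subr.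
have x'N : x' N = 0 by apply/eqP; rewrite -leqn0 -xN le.
have cle y z t : (forall I, y I <= z I) -> cov y t <= cov z t.
  by move=> yz; apply: cov_le.
split=> //.
(* Since the item is not blocked, every endpoint has enough surplus for the loss of one copy. For
   the dummy item, or if no copy is left, coverage does not change. *)
- move=> q qN; have := negbT bl; rewrite negb_exists => /forallP /(_ (Ordinal qN)) /=.
  rewrite -leqNgt => H; case: (ltngtP (st j) N) sj => // [sN | sE] _; last first.
    rewrite (@eq_cov _ x) ?fx // => I IN; rewrite x'E.
    by case: eqP => // e; move: IN; rewrite e sE ltnn.
  case: (posnP (x (st j))) => x0.
    rewrite (@eq_cov _ x) ?fx // => I IN; rewrite x'E.
    by case: eqP => // ->; rewrite x0.
  suff E : cov x (bd q) = cov x' (bd q) + cap (st j) * act (st j) (bd q).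
    by move: H; rewrite E leq_add2r.
  rewrite /cov (bigD1 (Ordinal sN)) //= [in RHS](bigD1 (Ordinal sN)) //= x'E eqxx.
  rewrite [X in _ = _ + X + _](eq_bigr (fun I : 'I_N => act I (bd q) * (cap I * x I))).
    by case: (x (st j)) x0 => // y _; rewrite subn1 /= mulnS mulnDr [X in _ = _ + X]mulnC -addnA addnC.
  move=> I; rewrite -val_eqE /= => Ij.
  by rewrite x'E (negbTE Ij).
- by move=> I IN; apply: leq_trans (le I) (xu I IN).
- move=> I IN IS; rewrite x'E; case: eqP => [e | _]; last exact: xE.
  by move: IN IS; rewrite e => /fresh /negbTE ->.
- by move=> I IN IS; apply/eqP; rewrite -leqn0 -(xo I IN IS) le.
- move=> i ij iN I IN IS x0.
  have [q [qN aq lt]] := xm i ij iN I IN IS (leq_trans x0 (le I)).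
  exists q; split=> //; apply: leq_ltn_trans lt; apply: cle => J.
  by rewrite /blend; case: ifP.
- move=> I IN IS Ij x0; have [q [qN aq lt]] := xr I IN IS Ij (leq_trans x0 (le I)).
  by exists q; split=> //; apply: leq_ltn_trans lt; apply: cle.
- case: xt => [|xt]; first by rewrite bl.
  right; rewrite x'E eqxx; apply: leq_trans (leq_sub2r 1 xt) _.
  by rewrite -subnDA addn1.
Qed.

(** After [u (st j)] attempts the item is either blocked, hence essential, or has no copy left. *)
Lemma pruned_step st j l x : j < N -> st j <= N -> u (st j) <= l ->
  partial st j l x -> pruned st j x.
Proof.
move=> jN sj ul [fx xu xE xo xm xr xt xN]; split=> // i; rewrite leq_eqVlt.
case/orP=> [/eqP <- | ji] iN; last exact: xm.
move=> I IN IS x0.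
suff [q [qN aq lt]] : exists q, [/\ q < 2 * N, act I (bd q) = 1
    & cov x (bd q) < dem (bd q) + cap I].
  by exists q; split=> //; rewrite (@eq_cov _ x) // => J JN; apply: blend_full.
case: (eqVneq I (st j)) => [e | Ij]; last exact: xr.
case: xt => [|xt]; last by move: x0; rewrite e; lia.
rewrite -e => /existsP[q lt]; exists q; have := fx q (ltn_ord q).
(* Feasibility rules out that the item is inactive at the blocking endpoint. *)
move: lt; rewrite actE => lt le; move: lt; case: (_ <= _ < _) => /=.
  by rewrite muln1.
by rewrite muln0; lia.
Qed.

(** An item of capacity 0 is never essential. Negative capacities are loaded as 0, so this keeps
    resources of negative capacity out of the output. *)
Lemma pruned_cap st x I : pruned st 0 x -> I < N -> 0 < x I -> 0 < cap I.
Proof.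
move=> [fx _ _ _ xm _] IN x0.
have [//|q [qN _ lt]] := xm 0 (leqnn _) (leq0n _) I IN _ x0.
have := fx q qN; rewrite (@eq_cov x (blend st 0 x)) // => le.
by move: (leq_ltn_trans le lt); rewrite -[X in X < _]addn0 ltn_add2l.
Qed.

(** All items of [y] lie on the stack, where residual prices are 0; so the scaled price of [y] is at
    most [4 * Y], and that of any cover is at least [Y]. *)
Lemma pruned_approx r x st z :
  descent N r x st -> forall y, pruned st 0 y ->
  (forall I, I < N -> z I <= u I) -> feas z ->
  dot price y <= 4 * dot price z.
Proof.
move=> [[sg [Y [sg0 lower upper]]] _ rE _ _ _] y [fy _ _ yo ym _] zu fz.
have ry : dot r y = 0.
  rewrite /dot big1 // => I _; case: (boolP ((I : nat) \in mkseq st N)) => IS.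
    by rewrite rE.
  by rewrite yo // muln0.
have := lower z zu fz; have := upper y (fun j jN => ym j (leq0n j) (ltnW jN)).
rewrite ry -(leq_pmul2l sg0); nia.
Qed.

End Covering.

(** * The program *)

(** Replacing whole arrays lets a read from an untouched array reduce by computation. *)
Definition setarr (s : store) (a : nat) (f : nat -> nat) : store :=
  fun a' => if a' == a then f else s a'.

Definition setcell (f : nat -> nat) (i v : nat) : nat -> nat :=
  fun j => if j == i then v else f j.

Lemma updateEarr s a i v : update s a i v = setarr s a (setcell (s a) i v).
Proof.
apply: functional_extensionality => a'; apply: functional_extensionality => i'.
by rewrite /update /setarr /setcell; case: (a' =P a) => [->|].
Qed.

Lemma bounded_setarr b L s a f : a != LIM -> bounded b L s ->
  (forall i, f i < 2 ^ b) -> bounded b L (setarr s a f).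
Proof.
move=> aL [bs sL] fb; split=> [a' i|l]; rewrite /setarr; first by case: eqP.
by rewrite eq_sym (negbTE aL).
Qed.

Lemma fspec_write b L env a e1 e2 s (Q : store -> Prop) : a != LIM ->
  bounded b L s -> aval s env e2 < 2 ^ b ->
  (bounded b L (setarr s a (setcell (s a) (aval s env e1) (aval s env e2))) ->
    Q (setarr s a (setcell (s a) (aval s env e1) (aval s env e2)))) ->
  fspec b L env (FWrite a e1 e2) s Q.
Proof.
move=> aL bs vb q; rewrite /fspec /= updateEarr.
have bs' : bounded b L (setarr s a (setcell (s a) (aval s env e1) (aval s env e2))).
  by apply: bounded_setarr => // i; rewrite /setcell; case: eqP => // _; case: bs.
by split; last exact: q.
Qed.

Lemma fspec_write_at b L env a e1 e2 s i v (Q : store -> Prop) : a != LIM ->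
  bounded b L s -> aval s env e1 = i -> aval s env e2 = v -> v < 2 ^ b ->
  (bounded b L (setarr s a (setcell (s a) i v)) ->
    Q (setarr s a (setcell (s a) i v))) ->
  fspec b L env (FWrite a e1 e2) s Q.
Proof. by move=> aL bs <- <-; apply: fspec_write. Qed.

(** In iteration [i] the cells of [a] from [i] on still hold their old contents. The function [g]
    expresses this, so that [e] may read the very cell being overwritten. *)
Lemma fspec_fill b L env l a e s (f : nat -> nat) (Q : store -> Prop) :
  a != LIM -> bounded b L s ->
  (forall i g, i < s LIM l -> (forall j, i <= j -> g j = s a j) ->
    aval (setarr s a g) (i :: env) e = f i) ->
  (forall i, i < s LIM l -> f i < 2 ^ b) ->
  (bounded b L (setarr s a (fun j => if j < s LIM l then f j else s a j)) ->
    Q (setarr s a (fun j => if j < s LIM l then f j else s a j))) ->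
  fspec b L env (FFor l (FWrite a (AVar 0) e)) s Q.
Proof.
move=> aL bs fE fb q.
pose S i := setarr s a (fun j => if j < i then f j else s a j).
have bS i : i <= s LIM l -> bounded b L (S i).
  move=> il; apply: bounded_setarr => // j; case: ifP => ji; last by case: bs.
  by apply: fb; apply: leq_trans il.
pose P i s' := s' = S i /\ i <= s LIM l.
suff H : fspec b L env (FFor l (FWrite a (AVar 0) e)) s (P (s LIM l)).
  by apply: fspec_impl H => s' [-> _]; apply/q/bS.
apply: fspec_for.
  split=> //; apply: functional_extensionality => a'; rewrite /S /setarr.
  by case: eqP => // ->.
move=> i s' il [-> _].
have E : aval (S i) (i :: env) e = f i by apply: fE => // j; rewrite ltnNge => ->.
apply: fspec_write => //; [exact/bS/ltnW | by rewrite E; apply: fb | move=> _].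
split=> //; rewrite E /S /setarr /=; apply: functional_extensionality => a'.
case: eqP => // _; rewrite eqxx; apply: functional_extensionality => j.
by rewrite /setcell ltnS [j <= i]leq_eqVlt; case: eqP => [-> | _].
Qed.

(** The inner sum vanishes exactly for the indices before the first one where [p] is positive, so
    the outer sum counts them. This replaces a search by arithmetic. *)
Lemma sum_first M (p : nat -> nat) :
  let v := \sum_(i < M) ((\sum_(j < M) (val j <= val i) * p (val j)) == 0) in
  (v < M /\ 0 < p v) \/ (v = M /\ forall j, j < M -> p j = 0).
Proof.
move=> v.
case: (boolP [exists i : 'I_M, 0 < p i]) => [/existsP ex | none]; last first.
  have p0 j : j < M -> p j = 0.
    move=> jM; move: none; rewrite negb_exists => /forallP /(_ (Ordinal jM)) /=.
    by rewrite -eqn0Ngt => /eqP.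
  right; split=> //; rewrite /v (eq_bigr (fun => 1)) ?sum_nat_const ?card_ord ?muln1 //.
  by move=> i _; rewrite big1 // => j _; rewrite p0 ?muln0 ?ltn_ord.
left; have ex' : exists i, (i < M) && (0 < p i).
  by case: ex => i pi; exists i; rewrite ltn_ord.
case: (ex_minnP ex') => w /andP[wM pw] wmin.
suff -> : v = w by [].
have E (i : 'I_M) : ((\sum_(j < M) (val j <= val i) * p (val j)) == 0) = (i < w).
  case: ltnP => iw.
    apply/eqP; rewrite big1 // => j _; case: leqP => //= ji.
    apply/eqP; rewrite mul1n -leqn0 leqNgt; apply/negP => pj.
    by have := wmin j; rewrite ltn_ord pj => /(_ isT); lia.
  apply/negbTE; rewrite -lt0n (bigD1 (Ordinal wM)) //= iw mul1n.
  by apply: leq_trans pw (leq_addr _ _).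
rewrite /v (eq_bigr (fun i : 'I_M => (i < w) : nat)) => [|i _]; last by rewrite E.
rewrite -(big_mkord xpredT (fun i => (i < w) : nat)) (big_cat_nat (n := w)) //=; last exact: ltnW.
rewrite (eq_big_nat _ _ (F2 := fun => 1)) => [|i /andP[_ ->]//].
rewrite sum_nat_const_nat subn0 muln1 big_nat big1 ?addn0 // => i /andP[wi _].
by rewrite ltnNge wi.
Qed.

(* Items [I < m] are the resources, the other ones are the jobs; item [I] is active
   from cell [2 * I] of [aEND] until just before cell [2 * I + 1]. *)
Notation aIN := 0 (only parsing).
Notation aOUT := 1 (only parsing).
Notation aLIM := 2 (only parsing).
Notation aEND := 3 (only parsing).
Notation aCAP := 4 (only parsing).
Notation aNUM := 5 (only parsing).
Notation aDEN := 6 (only parsing).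
Notation aMAX := 7 (only parsing).
Notation aRESIDUAL := 8 (only parsing).
Notation aCOPIES := 9 (only parsing).
Notation aDEFICIT := 10 (only parsing).
Notation aWEIGHT := 11 (only parsing).
Notation aSTACK := 12 (only parsing).
Notation aDENOM := 13 (only parsing).
Notation aTIME := 14 (only parsing).
Notation aITEM := 15 (only parsing).
Notation aFACTOR := 16 (only parsing).
Notation aCHARGE := 17 (only parsing).

Declare Scope aexp_scope.
Delimit Scope aexp_scope with A.
Bind Scope aexp_scope with aexp.
Infix "+" := (ABin Add) : aexp_scope.
Infix "-" := (ABin Defs.Sub) : aexp_scope.
Infix "*" := (ABin Mul) : aexp_scope.
Infix "%/" := (ABin Div) : aexp_scope.
Infix "<=" := (ABin Leq) : aexp_scope.
Infix "==" := (ABin Eql) : aexp_scope.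
Notation "a .[ e ]" := (ARead a e) : aexp_scope.
Notation "# n" := (AConst n) (at level 1, format "# n") : aexp_scope.
Notation "$ k" := (AVar k) (at level 1, format "$ k") : aexp_scope.
Notation "c1 ;; c2" := (FSeq c1 c2) (at level 60, right associativity).

Open Scope nat_scope.

Definition e_act (i t : aexp) : aexp :=
  (aEND.[#2 * i] <= t) * (t + #1 <= aEND.[#2 * i + #1]).

Definition e_dem (t : aexp) : aexp := ASum 0 ((aIN.[#3] <= $0) * e_act $0 t).

Definition e_cov (t : aexp) : aexp :=
  ASum 0 (e_act $0 t * (aCAP.[$0] * aCOPIES.[$0])).

(* The least loop value at which [p] is nonzero, or [LIM[l]] if there is none. *)
Definition e_first (l : nat) (p : aexp) : aexp :=
  ASum l (ASum l (($0 <= $1) * p) == #0).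

(** The factor and the charge are copied to scalars because the last loop overwrites the residual
    price from which the charge is read. *)
Definition descend : fprog :=
  FFor 1 (FWrite aDEFICIT $0 (e_dem (aEND.[$1]) - e_cov (aEND.[$1]))) ;;
  FWrite aTIME #0 (e_first 1 (ASum 1 (aDEFICIT.[$1] + #1 <= aDEFICIT.[$0]) == #0)) ;;
  FFor 0 (FWrite aWEIGHT $0 (e_act $0 (aEND.[aTIME.[#0]]) * (aCOPIES.[$0] == #0)
                        * (aCAP.[$0] - (aCAP.[$0] - aDEFICIT.[aTIME.[#0]])))) ;;
  FWrite aITEM #0 (e_first 0 ((#1 <= aWEIGHT.[$0]) *
    (ASum 0 (aRESIDUAL.[$0] * aWEIGHT.[$1] + #1 <= aRESIDUAL.[$1] * aWEIGHT.[$0]) == #0))) ;;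
  FWrite aSTACK $0 (aITEM.[#0]) ;;
  FWrite aCOPIES (aITEM.[#0]) (aMAX.[aITEM.[#0]]) ;;
  FWrite aFACTOR #0 (aWEIGHT.[aITEM.[#0]] + (aWEIGHT.[aITEM.[#0]] == #0)) ;;
  FWrite aCHARGE #0 (aRESIDUAL.[aITEM.[#0]]) ;;
  FFor 0 (FWrite aRESIDUAL $0 (aRESIDUAL.[$0] * aFACTOR.[#0] - aCHARGE.[#0] * aWEIGHT.[$0])).

(** Iteration [k] treats the item of round [N - (k + 1)]. The inner loop runs as often as the
    largest multiplicity allows, and subtracts the indicator of the item not being blocked. *)
Definition prune : fprog :=
  FWrite aITEM #0 (aSTACK.[aLIM.[#0] - ($0 + #1)]) ;;
  FFor 2 (FWrite aCOPIES (aITEM.[#0]) (aCOPIES.[aITEM.[#0]] -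
    (ASum 1 (e_cov (aEND.[$1]) + #1 <=
       e_dem (aEND.[$1]) + aCAP.[aITEM.[#0]] * e_act (aITEM.[#0]) (aEND.[$0])) == #0))).

(** * Verification of the two phases *)

Section Verification.

Variables (N m n1 ell b L : nat) (bd cap u price : nat -> nat).

Hypothesis cap_job : forall I, m <= I -> I < N -> cap I = 1.
Hypothesis u_job : forall I, m <= I -> I < N -> u I = 1.
Hypothesis u_gt0 : forall I, I < N -> 0 < u I.
Hypothesis u_N : u N = 0.
Hypothesis u_le : forall I, u I <= n1.
Hypothesis N_lt : N < 2 ^ ell.
Hypothesis ell_b : ell * (N + 3) <= b.

Record static (s : store) : Prop := Static {
  static_bounded : bounded b L s;
  static_lim : [/\ s LIM 0 = N, s LIM 1 = 2 * N & s LIM 2 = n1];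
  static_lim3 : s LIM 3 = N.+1;
  static_m : s aIN 3 = m;
  static_bd : s aEND = bd;
  static_cap : s aCAP = cap;
  static_u : s aMAX = u }.

Lemma static_setarr s a f : a \notin [:: 0; 2; 3; 4; 7] -> static s ->
  bounded b L (setarr s a f) -> static (setarr s a f).
Proof.
move=> na [bs sL sL3 sm sbd scap su] bs'.
have E c : c \in [:: 0; 2; 3; 4; 7] -> setarr s a f c = s c.
  by rewrite /setarr; case: eqP => // -> ca; rewrite ca in na.
by split; rewrite // ?E.
Qed.

Lemma N_lt_b : N < 2 ^ b.
Proof. by apply: leq_trans N_lt _; rewrite leq_exp2l //; lia. Qed.

Lemma dem_le t : dem N m bd t <= N.
Proof.
rewrite -[leqRHS]card_ord -sum1_card; apply: leq_sum => I _.
by rewrite actE mulnb leq_b1.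
Qed.

Lemma exc_le x q : exc N m bd cap x q <= N.
Proof. exact: leq_trans (leq_subr _ _) (dem_le _). Qed.

Lemma weight_le x q I : weight N m bd cap x q I <= N.
Proof.
rewrite /weight actE; apply: leq_trans (exc_le x q).
have : cap I - (cap I - exc N m bd cap x q) <= exc N m bd cap x q by lia.
by case: (_ <= _ < _) => //=; case: eqP => //= _; rewrite !mul1n.
Qed.

(** A round multiplies residual prices by at most [N < 2 ^ ell], so their bit bound grows by [ell]
    per round. *)
Record inv (k : nat) (s : store) : Prop := Inv {
  inv_static : static s;
  inv_W : forall i, N <= i -> s aWEIGHT i = 0;
  inv_descent : descent N m bd cap u price k (s aRESIDUAL) (s aCOPIES) (s aSTACK);
  inv_R : forall i, s aRESIDUAL i < 2 ^ (ell * (k + 3));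
  inv_ST : forall i, s aSTACK i <= N }.

Lemma descend_step s k : k < N -> inv k s -> fspec b L [:: k] descend s (inv k.+1).
Proof.
move=> kN [st W0 ds Rb STb].
have Nb := N_lt_b.
have [l0 l1 l2] := static_lim st.
apply: fspec_seq; apply: (fspec_fill (f := exc N m bd cap (s aCOPIES))) => //.
- exact: static_bounded st.
- move=> i g il gE; rewrite /= /setarr /= -/LIM l0.
  by rewrite (static_m st) (static_bd st) (static_cap st).
- by move=> i _; apply: leq_ltn_trans (exc_le _ _) Nb.
rewrite l1; set s1 := setarr _ _ _ => bs1.
have st1 : static s1 by apply: static_setarr.
have E1 q : q < 2 * N -> s1 aDEFICIT q = exc N m bd cap (s aCOPIES) q.
  by move=> qN; rewrite /s1 /setarr /= qN.
have A1 : [/\ s1 aWEIGHT = s aWEIGHT, s1 aRESIDUAL = s aRESIDUAL,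
  s1 aCOPIES = s aCOPIES & s1 aSTACK = s aSTACK] by [].
(* The store is abstracted to the facts used below, so that later simplification does not unfold
   earlier assignments. *)
move: s1 bs1 st1 E1 A1 => s1 bs1 st1 E1 [A1W A1R A1X A1ST].
have [l10 l11 _] := static_lim st1.
pose p1 q := (\sum_(q' < s1 LIM 1) (s1 aDEFICIT q + 1 <= s1 aDEFICIT (val q'))) == 0 : nat.
have [q0 q0E] : exists q0,
  aval s1 [:: k] (e_first 1 (ASum 1 (aDEFICIT.[$1] + #1 <= aDEFICIT.[$0]) == #0)%A) = q0.
  by eexists.
have q0P : (q0 < s1 LIM 1 /\ 0 < p1 q0) \/
    (q0 = s1 LIM 1 /\ forall j, j < s1 LIM 1 -> p1 j = 0).
  by rewrite -q0E; exact: (sum_first (s1 LIM 1) p1).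
have [q0N q0max] : q0 < 2 * N /\
    forall q, q < 2 * N -> exc N m bd cap (s aCOPIES) q <= exc N m bd cap (s aCOPIES) q0.
  case: q0P => [[q0N pq0] | [_ none]].
    rewrite l11 in q0N; split=> // q qN; rewrite leqNgt; apply/negP => lt.
    move: pq0; rewrite /p1 l11 (bigD1 (Ordinal qN)) //= addn1 !E1 //.
    by rewrite lt addn_eq0.
  (* The search cannot fail, since a maximal deficit exists. *)
  have z2 : 0 < 2 * N by lia.
  case: (@arg_maxnP _ (Ordinal z2) xpredT (fun q => s1 aDEFICIT (val q)) isT) => q _ qmax.
  have := none q; rewrite l11 ltn_ord => /(_ isT).
  rewrite /p1 l11 big1 // => q' _; apply/eqP; rewrite eqb0 -ltnNge addn1 ltnS.
  exact: qmax.
apply: fspec_seq; apply: (fspec_write_at (i := 0) (v := q0)) => //.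
  by apply: ltn_trans q0N _; rewrite -l11; apply: bs1.1.
set s2 := setarr _ _ _ => bs2.
have st2 : static s2 by apply: static_setarr.
have E2 : [/\ s2 aDEFICIT = s1 aDEFICIT, s2 aTIME 0 = q0, s2 aWEIGHT = s aWEIGHT, s2 aRESIDUAL = s aRESIDUAL
  & s2 aCOPIES = s aCOPIES /\ s2 aSTACK = s aSTACK] by [].
move: s2 bs2 st2 E2 => s2 bs2 st2 [A2E A2Q A2W A2R [A2X A2ST]].
have [l20 _ _] := static_lim st2.
have q0E1 := E1 _ q0N.
apply: fspec_seq; apply: (fspec_fill (f := weight N m bd cap (s aCOPIES) q0)) => //.
- move=> i g il gE; rewrite /= /setarr /= A2Q A2E q0E1 A2X.
  by rewrite (static_bd st2) (static_cap st2).
- by move=> i _; apply: leq_ltn_trans (weight_le _ _ _) Nb.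
rewrite l20; set W := fun j => if _ then _ else _ => bs3.
set s3 := setarr _ _ _ in bs3 *.
have WE I : I < N -> W I = weight N m bd cap (s aCOPIES) q0 I by rewrite /W => ->.
(* Cell [N] stays 0; it is read as the weight of the dummy item. *)
have WN i : N <= i -> W i = 0 by rewrite /W A2W ltnNge => Ni; rewrite Ni W0.
have Wle i : W i <= N.
  by rewrite /W; case: ltnP => iN; [apply: weight_le | rewrite A2W W0].
have st3 : static s3 by apply: static_setarr.
have E3 : [/\ s3 aWEIGHT = W, s3 aRESIDUAL = s aRESIDUAL,
  s3 aCOPIES = s aCOPIES & s3 aSTACK = s aSTACK] by [].
move: W WE WN Wle s3 bs3 st3 E3 => W WE WN Wle s3 bs3 st3 [A3W A3R A3X A3ST].
have [l30 _ _] := static_lim st3.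
pose p3 I : nat := (1 <= W I) *
  ((\sum_(J < N) (s aRESIDUAL J * W I + 1 <= s aRESIDUAL I * W J)) == 0).
have p3P I : reflect (chosen N (s aRESIDUAL) W I) (0 < p3 I).
  rewrite /p3 muln_gt0 !lt0b; apply: (iffP andP) => [[WI /eqP S0] | [WI cI]].
    split=> // J JN; rewrite leqNgt; apply/negP => lt.
    by move: S0; rewrite (bigD1 (Ordinal JN)) //= addn1 lt.
  split=> //; rewrite big1 // => J _; apply/eqP; rewrite eqb0 addn1 -leqNgt.
  exact: cI.
have [c cE] : exists c, aval s3 [:: k] (e_first 0 ((#1 <= aWEIGHT.[$0]) *
    (ASum 0 (aRESIDUAL.[$0] * aWEIGHT.[$1] + #1 <= aRESIDUAL.[$1] * aWEIGHT.[$0]) == #0))%A) = c.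
  by eexists.
have cP : (c < N /\ chosen N (s aRESIDUAL) W c)
    \/ (c = N /\ forall I, I < N -> ~ chosen N (s aRESIDUAL) W I).
  have := sum_first N p3; set v := \sum_(i < N) _; suff -> : v = c.
    case=> [[cN /p3P] | [cN none]]; [by left | right].
    by split=> // I IN /p3P; rewrite none.
  by rewrite -cE /= l30 A3R A3W.
have cN : c <= N by case: cP => [[/ltnW] | [->]].
apply: fspec_seq; apply: (fspec_write_at (i := 0) (v := c)) => //.
  exact: leq_ltn_trans cN Nb.
set s4 := setarr _ _ _ => bs4; have st4 : static s4 by apply: static_setarr.
apply: fspec_seq; apply: (fspec_write_at (i := k) (v := c)) => //.
  exact: leq_ltn_trans cN Nb.
set s5 := setarr _ _ _ => bs5; have st5 : static s5 by apply: static_setarr.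
have u5 : s5 aMAX = u by case: st5.
apply: fspec_seq; apply: (fspec_write_at (i := c) (v := u c)) => //.
- by rewrite /= u5.
- by rewrite -u5; apply: bs5.1.
set s6 := setarr _ _ _ => bs6; have st6 : static s6 by apply: static_setarr.
have Db : W c + (W c == 0) <= N by case: (W c) (Wle c) => [|w] /=; lia.
have [A6W A6C] : s6 aWEIGHT = W /\ s6 aITEM 0 = c by rewrite -A3W.
apply: fspec_seq; apply: (fspec_write_at (i := 0) (v := W c + (W c == 0))) => //.
- by rewrite /= A6W A6C.
- exact: leq_ltn_trans Db Nb.
set s7 := setarr _ _ _ => bs7; have st7 : static s7 by apply: static_setarr.
have [A7R A7C] : s7 aRESIDUAL = s aRESIDUAL /\ s7 aITEM 0 = c by rewrite -A3R.
apply: fspec_seq; apply: (fspec_write_at (i := 0) (v := s aRESIDUAL c)) => //.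
- by rewrite /= A7C A7R.
- by rewrite -A7R; apply: bs7.1.
set s8 := setarr _ _ _ => bs8; have st8 : static s8 by apply: static_setarr.
have [A8R A8W A8D A8C] : [/\ s8 aRESIDUAL = s aRESIDUAL, s8 aWEIGHT = W,
    s8 aFACTOR 0 = W c + (W c == 0) & s8 aCHARGE 0 = s aRESIDUAL c].
  by split; [exact: A3R | exact: A3W | |].
have A8X : s8 aCOPIES = setcell (s aCOPIES) c (u c) by rewrite -A3X.
have A8ST : s8 aSTACK = setcell (s aSTACK) k c by rewrite -A3ST.
move: s8 bs8 st8 A8R A8W A8D A8C A8X A8ST => s8 bs8 st8 A8R A8W A8D A8C A8X A8ST.
have [l80 _ _] := static_lim st8.
pose r' I := s aRESIDUAL I * (W c + (W c == 0)) - s aRESIDUAL c * W I.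
have r'b I : r' I < 2 ^ (ell * (k.+1 + 3)).
  apply: leq_ltn_trans (leq_subr _ _) _.
  apply: (@leq_ltn_trans (s aRESIDUAL I * 2 ^ ell)).
    by rewrite leq_mul2l (leq_trans Db (ltnW N_lt)) orbT.
  by rewrite addSn mulnS addnC expnD ltn_pmul2r ?expn_gt0.
have eb : ell * (k.+1 + 3) <= b.
  by apply: leq_trans ell_b; rewrite leq_mul2l leq_add2r kN orbT.
apply: (fspec_fill (f := r')) => //.
- by move=> i g il gE; rewrite /= /setarr /= A8D A8C A8W gE // A8R.
- by move=> i _; apply: leq_trans (r'b i) _; rewrite leq_exp2l.
rewrite l80 => bs9; split.
- exact: static_setarr.
- by move=> i Ni; rewrite /setarr /= A8W WN.
- rewrite /setarr /= A8X A8ST.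
  apply: (descentS cap_job u_gt0 u_N ds kN q0N q0max WE (WN _ (leqnn _)) cP) => //.
  by move=> I IN; rewrite IN.
- move=> i; rewrite /setarr /=; case: ifP => // _; rewrite A8R.
  apply: leq_trans (Rb i) _.
  by rewrite leq_exp2l // leq_mul2l leq_add2r leqnSn orbT.
- by move=> i; rewrite /setarr /= A8ST /setcell; case: eqP.
Qed.

Lemma prune_step (st : nat -> nat) s k : k < N ->
  static s -> s aSTACK = st -> (forall i, st i <= N) ->
  (forall j, j < N -> st j < N -> st j \notin mkseq st j) ->
  pruned N m bd cap u st (N - k) (s aCOPIES) ->
  fspec b L [:: k] prune s (fun s' => [/\ static s', s' aSTACK = st
    & pruned N m bd cap u st (N - k.+1) (s' aCOPIES)]).
Proof.
move=> kN ss sST stN fresh px; have Nb := N_lt_b.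
have [l0 _ _] := static_lim ss.
set j := N - k.+1; have jN : j < N by rewrite /j; lia.
have jk : N - k = j.+1 by rewrite /j; lia.
rewrite jk in px.
apply: fspec_seq; apply: (fspec_write_at (i := 0) (v := st j)) => //.
- exact: static_bounded ss.
- by rewrite /= addn1 sST l0.
- exact: leq_ltn_trans (stN _) Nb.
set s0 := setarr _ _ _ => bs0; have ss0 : static s0 by apply: static_setarr.
have [_ _ l02] := static_lim ss0.
have P0 := partial0 jN (stN j) px.
pose P l (s' : store) := [/\ static s', s' aSTACK = st, s' aITEM 0 = st j
  & partial N m bd cap u st j l (s' aCOPIES)].
suff H : fspec b L [:: k] (FFor 2 (FWrite aCOPIES (aITEM.[#0]) (aCOPIES.[aITEM.[#0]] -
    (ASum 1 (e_cov (aEND.[$1]) + #1 <=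
       e_dem (aEND.[$1]) + aCAP.[aITEM.[#0]] * e_act (aITEM.[#0]) (aEND.[$0])) == #0))%A))
    s0 (P (s0 LIM 2)).
  apply: fspec_impl H => s' [ss' sST' _ pp]; split=> //.
  by apply: pruned_step pp => //; rewrite l02.
apply: fspec_for; first by split.
move=> l s' ll [ss' sST' sC' pp]; have [l0' l1' _] := static_lim ss'.
pose bl := blocked N m bd cap (s' aCOPIES) (st j).
apply: (fspec_write_at (i := st j) (v := s' aCOPIES (st j) - ~~ bl)) => //.
- exact: static_bounded ss'.
- rewrite /= sC'; congr (_ - _).
  rewrite l0' l1' (static_m ss') (static_bd ss') (static_cap ss').
  rewrite sum_nat_eq0 /bl /blocked negb_exists; congr nat_of_bool.
  apply: eq_forallb => q; rewrite eqb0 addn1 -/(cov _ _ _ _ _) -/(dem _ _ _ _).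
  by [].
- by apply: leq_ltn_trans (leq_subr _ _) _; apply: (static_bounded ss').1.
move=> bs1; split=> //; first exact: static_setarr.
apply: (partialS jN (stN j) (fresh j jN) pp) => I.
by rewrite /setarr /= /setcell; case: eqP => [->|].
Qed.

Lemma solve_spec s : inv 0 s ->
  fspec b L [::] (FFor 0 descend ;; FFor 0 prune) s (fun s' =>
    [/\ static s', feas N m bd cap (s' aCOPIES), forall I, I < N -> s' aCOPIES I <= u I,
        forall I, I < N -> 0 < s' aCOPIES I -> 0 < cap I
      & forall z, (forall I, I < N -> z I <= u I) -> feas N m bd cap z ->
          dot N price (s' aCOPIES) <= 4 * dot N price z]).
Proof.
move=> i0; apply: fspec_seq.
have H : fspec b L [::] (FFor 0 descend) s (inv (s LIM 0)).
  apply: fspec_for => // k s' kl ik; apply: descend_step => //.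
  by have [l0 _ _] := static_lim (inv_static i0); rewrite -l0.
have [l0 _ _] := static_lim (inv_static i0).
apply: fspec_impl H => s1; rewrite l0 => -[ss1 _ ds _ stN].
have fresh := descent_fresh ds.
pose P k (s' : store) := [/\ static s', s' aSTACK = s1 aSTACK
    & pruned N m bd cap u (s1 aSTACK) (N - k) (s' aCOPIES)].
have [l10 _ _] := static_lim ss1.
have {}H : fspec b L [::] (FFor 0 prune) s1 (P (s1 LIM 0)).
  apply: fspec_for => [|k s' kl [ss' sST pp]].
    by split; rewrite // subn0; apply: (prunedN cap_job u_job ds).
  by apply: prune_step => //; rewrite -l10.
apply: fspec_impl H => s2 [ss2 _]; rewrite l10 subnn => pp.
split=> //; [by case: pp | by case: pp | |].
  by move=> I; apply: pruned_cap pp.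
by move=> z zu fz; apply: pruned_approx ds _ pp zu fz.
Qed.

End Verification.

(** Indicators replace a conditional. Both branches are evaluated, and the one that does not apply,
    possibly read from a meaningless address, is multiplied by 0. *)
Definition e_sel (i a b : aexp) : aexp := (i + #1 <= aIN.[#3]) * a + (aIN.[#3] <= i) * b.
(** Input cells 0 to 3 hold the length, the horizon and the numbers of jobs and resources. Jobs
    follow from cell 4 with 4 numbers each, then resources with 6 numbers each; so field offsets
    start at 4. *)
Definition e_res (o : nat) (i : aexp) : aexp := aIN.[#o + #4 * aIN.[#2] + #6 * i].
Definition e_job (o : nat) (i : aexp) : aexp := aIN.[#o + #4 * (i - aIN.[#3])].

(** The sign flag turns negative capacities into 0. Multiplicities are bounded by [n + 1], which is
    positive even without jobs; interval ends move up by one to become half-open. Prices are made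
    integral by the product of all denominators. *)
Definition load : fprog :=
  FWrite LIM #0 (aIN.[#3] + aIN.[#2]) ;;
  FWrite LIM #1 (#2 * (aIN.[#3] + aIN.[#2])) ;;
  FWrite LIM #2 (aIN.[#2] + #1) ;;
  FWrite LIM #3 (aIN.[#3] + aIN.[#2] + #1) ;;
  FFor 0 (FWrite aCAP $0 (e_sel $0 ((#1 - e_res 6 $0) * e_res 7 $0) #1)) ;;
  FFor 0 (FWrite aMAX $0 (e_sel $0 (aIN.[#2] + #1) #1)) ;;
  FFor 0 (FWrite aNUM $0 (e_sel $0 (e_res 8 $0) (e_job 6 $0))) ;;
  FFor 0 (FWrite aDEN $0 (e_sel $0 (e_res 9 $0) (e_job 7 $0))) ;;
  FFor 1 (FWrite aEND $0 (e_sel ($0 %/ #2)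
    (($0 == #2 * ($0 %/ #2)) * e_res 4 ($0 %/ #2)
     + ($0 == #2 * ($0 %/ #2) + #1) * (e_res 5 ($0 %/ #2) + #1))
    (($0 == #2 * ($0 %/ #2)) * e_job 4 ($0 %/ #2)
     + ($0 == #2 * ($0 %/ #2) + #1) * (e_job 5 ($0 %/ #2) + #1)))) ;;
  FWrite aDENOM #0 #1 ;;
  FFor 0 (FWrite aDENOM #0 (aDENOM.[#0] * aDEN.[$0])) ;;
  FFor 0 (FWrite aRESIDUAL $0 (aDENOM.[#0] * aNUM.[$0] %/ aDEN.[$0])).

(** Buying a job's item means rejecting the job, so its bit is inverted. *)
Definition report : fprog :=
  FFor 3 (FWrite aOUT $0 (($0 == #0) * aLIM.[#0] + (#1 <= $0) *
    e_sel ($0 - #1) (aCOPIES.[$0 - #1]) (#1 - aCOPIES.[$0 - #1]))).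

Definition prize_collecting : fprog :=
  load ;; (FFor 0 descend ;; FFor 0 prune) ;; report.

(** * Loading the input and running the whole program *)

Section Loading.

Variables (n m : nat) (inp : nat -> nat).
Let N := m + n.

Definition by_kind (f g : nat -> nat) (I : nat) : nat :=
  if I < m + n then if I < m then f I else g (I - m) else 0.

Definition in_res (o i : nat) := inp (o + 4 * n + 6 * i).
Definition in_job (o j : nat) := inp (o + 4 * j).

Definition in_cap := by_kind (fun i => (1 - in_res 6 i) * in_res 7 i) (fun=> 1).
Definition in_u := by_kind (fun=> n + 1) (fun=> 1).
Definition in_num := by_kind (in_res 8) (in_job 6).
Definition in_den := by_kind (in_res 9) (in_job 7).
Definition in_lo := by_kind (in_res 4) (in_job 4).
Definition in_hi := by_kind (fun i => in_res 5 i + 1) (fun j => in_job 5 j + 1).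
Definition in_bd q :=
  if q < 2 * (m + n) then if q == 2 * (q %/ 2) then in_lo (q %/ 2) else in_hi (q %/ 2)
  else 0.
Definition in_scale := \prod_(I < m + n) in_den I.
Definition in_price I := in_scale * in_num I %/ in_den I.

Lemma by_kindE f g I : I < N ->
  (I + 1 <= m) * f I + (m <= I) * g (I - m) = by_kind f g I.
Proof.
by rewrite /by_kind -/N addn1 => ->; case: ltnP => _; rewrite !mul1n !mul0n ?addn0.
Qed.

Lemma by_kind_out f g I : N <= I -> by_kind f g I = 0.
Proof. by rewrite /by_kind ltnNge => ->. Qed.

Lemma by_kind_le f g I c : (forall i, f i <= c) -> (forall j, g j <= c) ->
  by_kind f g I <= c.
Proof. by move=> fc gc; rewrite /by_kind; do 2?case: ifP. Qed.

Lemma in_bd_out q : 2 * N <= q -> in_bd q = 0.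
Proof. by rewrite /in_bd ltnNge => ->. Qed.

Lemma in_bdE q : q < 2 * N ->
  let i := q %/ 2 in
  (i + 1 <= m) * ((q == 2 * i) * in_res 4 i + (q == 2 * i + 1) * (in_res 5 i + 1))
  + (m <= i) * ((q == 2 * i) * in_job 4 (i - m)
                + (q == 2 * i + 1) * (in_job 5 (i - m) + 1)) = in_bd q.
Proof.
move=> qN i; have iN : i < N by rewrite /i; lia.
rewrite /in_bd -/N qN -/i /in_lo /in_hi -!by_kindE //.
have : q = 2 * i \/ q = 2 * i + 1 by rewrite /i; lia.
case=> ->; rewrite ?eqxx.
  have -> : (2 * i == 2 * i + 1) = false by lia.
  by rewrite !mul1n !mul0n !addn0.
have -> : (2 * i + 1 == 2 * i) = false by lia.
by rewrite !mul1n !mul0n !add0n.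
Qed.

Variable ell : nat.
Let b := ell * (ell + 3).

Hypothesis inp_n : inp 2 = n.
Hypothesis inp_m : inp 3 = m.
Hypothesis inp_lt : forall i, inp i < 2 ^ ell.
Hypothesis N_ell : 2 * N + 2 <= ell.
Hypothesis den_gt0 : forall I, I < N -> 0 < in_den I.
Hypothesis scale_lt : in_scale < 2 ^ ell.

Lemma small_lt v : v <= 2 ^ ell -> v < 2 ^ b.
Proof.
move=> vl; apply: leq_ltn_trans vl _; rewrite ltn_exp2l // /b.
by move: N_ell; nia.
Qed.

Lemma ell_small v : v <= ell -> v < 2 ^ b.
Proof. by move=> vl; apply/small_lt/(leq_trans vl)/ltnW/ltn_expl. Qed.

Lemma fspec_lim env e1 e2 s i v (Q : store -> Prop) :
  bounded b ell s -> aval s env e1 = i -> aval s env e2 = v -> v <= ell ->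
  (bounded b ell (setarr s LIM (setcell (s LIM) i v)) ->
    Q (setarr s LIM (setcell (s LIM) i v))) ->
  fspec b ell env (FWrite LIM e1 e2) s Q.
Proof.
move=> [bs sL] <- <- vb q; rewrite /fspec /= updateEarr.
have bs' : bounded b ell (setarr s LIM (setcell (s LIM) (aval s env e1) (aval s env e2))).
  split=> [a j|l]; last first.
    by rewrite /setarr eqxx /setcell; case: eqP.
  by rewrite /setarr /setcell; do 2?case: eqP => //; rewrite ell_small.
by split; last exact: q.
Qed.

Lemma fspec_load_array env l M a e s (f : nat -> nat) (Q : store -> Prop) :
  a != LIM -> bounded b ell s -> s LIM l = M ->
  (forall i, M <= i -> f i = 0) -> (forall i, s a i = 0) ->
  (forall i g, i < M -> aval (setarr s a g) (i :: env) e = f i) ->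
  (forall i, f i < 2 ^ b) ->
  (bounded b ell (setarr s a f) -> Q (setarr s a f)) ->
  fspec b ell env (FFor l (FWrite a (AVar 0) e)) s Q.
Proof.
move=> aL bs sl fM sa fE fb q; apply: (fspec_fill (f := f)) => //.
  by move=> i g il _; apply: fE; rewrite -sl.
suff -> : (fun j => if j < s LIM l then f j else s a j) = f by [].
apply: functional_extensionality => j; rewrite sl; case: ltnP => // Mj.
by rewrite fM.
Qed.

Lemma load_spec s0 : s0 0 = inp -> (forall a i, a != 0 -> s0 a i = 0) ->
  fspec b ell [::] load s0
    (inv N m n.+1 ell b ell in_bd in_cap in_u in_price 0).
Proof.
move=> s00 s0z.
have bs0 : bounded b ell s0.
  split=> [a i|l]; last by rewrite s0z.
  case: (eqVneq a 0) => [-> | az]; first by rewrite s00; apply/small_lt/ltnW.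
  by rewrite s0z // expn_gt0.
apply: fspec_seq; apply: (fspec_lim (i := 0) (v := N)) => //.
- by rewrite /= s00 inp_n inp_m.
- by move: N_ell; lia.
move=> bs1; apply: fspec_seq; apply: (fspec_lim (i := 1) (v := 2 * N)) => //.
- by rewrite /= /setarr /= s00 inp_n inp_m.
- by move: N_ell; lia.
move=> bs2; apply: fspec_seq; apply: (fspec_lim (i := 2) (v := n.+1)) => //.
- by rewrite /= /setarr /= s00 inp_n addn1.
- by move: N_ell; rewrite /N; lia.
move=> bs3; apply: fspec_seq; apply: (fspec_lim (i := 3) (v := N.+1)) => //.
- by rewrite /= /setarr /= s00 inp_n inp_m addn1.
- by move: N_ell; lia.
set s4 := setarr _ _ _ => bs4.
have [L0 L1 L2 L3] : [/\ s4 LIM 0 = N, s4 LIM 1 = 2 * N, s4 LIM 2 = n.+1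
  & s4 LIM 3 = N.+1] by [].
have s40 : s4 aIN = inp by rewrite -s00.
have s4z a i : 2 < a -> s4 a i = 0.
  move=> a2; rewrite -(s0z a i); last by case: a a2.
  by rewrite /s4 /setarr; case: eqP a2 => // ->.
move: s4 bs4 L0 L1 L2 L3 s40 s4z => s4 bs4 L0 L1 L2 L3 s40 s4z.
have u1 : 1 <= 2 ^ ell by rewrite expn_gt0.
have price_lt i : in_price i < 2 ^ (ell * (0 + 3)).
  apply: leq_ltn_trans (leq_div _ _) _.
  have num_lt : in_num i <= 2 ^ ell by apply/by_kind_le => j; apply/ltnW/inp_lt.
  apply: (@leq_ltn_trans (in_scale * 2 ^ ell)); first by rewrite leq_mul2l num_lt orbT.
  apply: (@leq_trans (2 ^ ell * 2 ^ ell)); first by rewrite ltn_pmul2r // expn_gt0.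
  by rewrite -expnD leq_exp2l //; lia.
have b3 : ell * (0 + 3) <= b by rewrite leq_mul2l add0n leq_addl orbT.
apply: fspec_seq; apply: (fspec_load_array (f := in_cap) _ bs4 L0) => //.
- by move=> i; apply: by_kind_out.
- by move=> i; apply: s4z.
- move=> i g iN; rewrite /in_cap -by_kindE //= /setarr /= s40 inp_n inp_m.
  by rewrite muln1.
- move=> i; apply/small_lt/by_kind_le => // j.
  apply: leq_trans (leq_mul (leq_subr _ _) (leqnn _)) _.
  by rewrite mul1n; apply/ltnW/inp_lt.
set s5 := setarr _ _ _ => bs5.
apply: fspec_seq; apply: (fspec_load_array (f := in_u) _ bs5 L0) => //.
- by move=> i; apply: by_kind_out.
- by move=> i; apply: s4z.
- move=> i g iN; rewrite /in_u -by_kindE //= /s5 /setarr /= s40 inp_n inp_m.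
  by rewrite muln1.
- move=> i; apply/ell_small/by_kind_le; move: N_ell; rewrite /N; lia.
set s6 := setarr _ _ _ => bs6.
apply: fspec_seq; apply: (fspec_load_array (f := in_num) _ bs6 L0) => //.
- by move=> i; apply: by_kind_out.
- by move=> i; apply: s4z.
- by move=> i g iN; rewrite /in_num -by_kindE //= /s6 /s5 /setarr /= s40 inp_n inp_m.
- by move=> i; apply/small_lt/by_kind_le => j; apply/ltnW/inp_lt.
set s7 := setarr _ _ _ => bs7.
apply: fspec_seq; apply: (fspec_load_array (f := in_den) _ bs7 L0) => //.
- by move=> i; apply: by_kind_out.
- by move=> i; apply: s4z.
- by move=> i g iN; rewrite /in_den -by_kindE //= /s7 /s6 /s5 /setarr /= s40 inp_n inp_m.
- by move=> i; apply/small_lt/by_kind_le => j; apply/ltnW/inp_lt.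
set s8 := setarr _ _ _ => bs8.
apply: fspec_seq; apply: (fspec_load_array (f := in_bd) _ bs8 L1) => //.
- by move=> i; apply: in_bd_out.
- by move=> i; apply: s4z.
- by move=> i g iN; rewrite -in_bdE //= /s8 /s7 /s6 /s5 /setarr /= s40 inp_n inp_m.
- move=> i; apply/small_lt; rewrite /in_bd; case: ifP => // _; case: ifP => _.
    by apply/by_kind_le => j; apply/ltnW/inp_lt.
  by apply/by_kind_le => j; rewrite addn1; apply/inp_lt.
set s9 := setarr _ _ _ => bs9.
apply: fspec_seq; apply: (fspec_write_at (i := 0) (v := 1)) => //.
  exact: small_lt.
set s10 := setarr _ _ _ => bs10.
pose S i := setarr s9 aDENOM (setcell (s9 aDENOM) 0 (\prod_(I < i) in_den I)).
pose P i s := s = S i /\ bounded b ell s.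
have L10 : s10 LIM 0 = N by [].
have H : fspec b ell [::] (FFor 0 (FWrite aDENOM #0 (aDENOM.[#0] * aDEN.[$0])%A)) s10 (P N).
  rewrite -L10; apply: fspec_for => [|i s' il [sE bs']].
    by rewrite /P /S big_ord0.
  apply: (fspec_write_at (i := 0) (v := \prod_(I < i.+1) in_den I)) => //.
  - by rewrite big_ord_recr /= sE.
  (* Denominators are positive, so partial products do not exceed the full one. *)
  - apply/small_lt/(leq_trans _ (ltnW scale_lt)).
    rewrite /in_scale -/N -!(big_mkord xpredT in_den).
    have iN : i < N by rewrite -L10.
    rewrite [leqRHS](big_cat_nat (n := i.+1)) //=; apply: leq_pmulr.
    by rewrite big_nat; apply: prodn_cond_gt0 => I /andP[_ IN]; apply: den_gt0.
  move=> bs''; split=> //; rewrite sE /S /setarr /=.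
  apply: functional_extensionality => a; case: eqP => // _.
  apply: functional_extensionality => j; rewrite /setcell.
  by case: eqP.
apply: fspec_seq; apply: fspec_impl H => s11 [-> bs11].
apply: (fspec_load_array (f := fun I => if I < N then in_price I else 0) _ bs11 L0) => //.
- by move=> i; rewrite ltnNge => ->.
- by move=> i; apply: s4z.
- by move=> i g iN; rewrite iN.
- move=> i; case: ifP => // _; last by rewrite expn_gt0.
  by apply: leq_trans (price_lt i) _; rewrite leq_exp2l.
move=> bs12; split.
- by split=> //; rewrite -inp_m -s40.
- by move=> i _; apply: s4z.
- apply: descent0 => I; last by move=> _; apply: s4z.
  by move=> IN; rewrite /setarr /= IN.
- by move=> i; rewrite /setarr /=; case: ifP => // _; rewrite expn_gt0.
- by move=> i; rewrite (_ : _ aSTACK i = 0) //; apply: s4z.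
Qed.

Lemma prize_collecting_spec s0 : s0 0 = inp -> (forall a i, a != 0 -> s0 a i = 0) ->
  fspec b ell [::] prize_collecting s0 (fun s => exists x,
    [/\ feas N m in_bd in_cap x,
        forall I, I < N -> x I <= in_u I /\ (0 < x I -> 0 < in_cap I),
        forall z, (forall I, I < N -> z I <= in_u I) -> feas N m in_bd in_cap z ->
          dot N in_price x <= 4 * dot N in_price z,
        s 1 0 = N
      & forall I, I < N -> s 1 I.+1 = if I < m then x I else 1 - x I]).
Proof.
move=> s00 s0z; have N_lt : N < 2 ^ ell.
  by apply: leq_ltn_trans (ltn_expl ell _) => //; lia.
have ell_b : ell * (N + 3) <= b by rewrite leq_mul2l leq_add2r; apply/orP; right; lia.
have cap_job I : m <= I -> I < N -> in_cap I = 1.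
  by move=> mI IN; rewrite /in_cap /by_kind -/N IN ltnNge mI.
have u_job I : m <= I -> I < N -> in_u I = 1.
  by move=> mI IN; rewrite /in_u /by_kind -/N IN ltnNge mI.
have u_gt0 I : I < N -> 0 < in_u I.
  by move=> IN; rewrite /in_u /by_kind -/N IN; case: ifP => _; lia.
have u_N : in_u N = 0 by apply: by_kind_out.
apply: fspec_seq; apply: fspec_impl (load_spec s00 s0z) => s1 i1.
have u_le I : in_u I <= n.+1 by apply: by_kind_le => _; lia.
have solved := solve_spec cap_job u_job u_gt0 u_N u_le N_lt ell_b i1.
apply: fspec_seq; apply: fspec_impl solved => s2 [ss2 fx xu xc approx].
pose out q := if q == 0 then N else if q - 1 < m then s2 aCOPIES (q - 1) else 1 - s2 aCOPIES (q - 1).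
have [l0 _ _] := static_lim ss2.
apply: (fspec_fill (f := out)) => //.
- exact: static_bounded ss2.
- move=> q g qN _; rewrite /= /setarr /= (static_m ss2) l0 /out addn1.
  case: q qN => [|q] qN //=; rewrite ?mul1n ?mul0n ?addn0 //.
  by rewrite subn1 /=; case: ltnP => _; rewrite ?mul1n ?mul0n ?addn0.
- move=> q _; rewrite /out; case: ifP => _; first by apply: ell_small; lia.
  by case: ifP => _; [apply: (static_bounded ss2).1 | apply: ell_small; lia].
move=> _; exists (s2 aCOPIES); rewrite /setarr /= (static_lim3 ss2); split=> //.
  by move=> I IN; split; [apply: xu | apply: xc].
by move=> I IN; rewrite ltnS IN /out /= subn1.
Qed.

End Loading.

(** * Instances and their encoding *)

Import Order.TTheory GRing.Theory Num.Theory.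

Lemma nth_flatten_map (T : Type) (f : T -> seq nat) (c : nat) (s : seq T) x0 i k :
  (forall x, size (f x) = c) -> i < size s -> k < c ->
  nth 0 (flatten (map f s)) (c * i + k) = nth 0 (f (nth x0 s i)) k.
Proof.
move=> fc; elim: s i => [//|x s IH] [|i] /= il kc; rewrite nth_cat fc.
  by rewrite muln0 add0n kc.
by rewrite mulnS -addnA ltnNge leq_addr /= addKn IH.
Qed.

Lemma size_flatten_map (T : Type) (f : T -> seq nat) (c : nat) (s : seq T) :
  (forall x, size (f x) = c) -> size (flatten (map f s)) = c * size s.
Proof.
move=> fc; elim: s => [|x s IH] /=; first by rewrite muln0.
by rewrite size_cat fc IH mulnS.
Qed.

Lemma bitlen_gt v : v < 2 ^ bitlen v.
Proof. by rewrite /bitlen; apply: trunc_log_ltn. Qed.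

Lemma input_length_cat x y : input_length (x ++ y) = input_length x + input_length y.
Proof. by rewrite /input_length big_cat. Qed.

Lemma size_input_length x : size x <= input_length x.
Proof.
by rewrite -sum1_size; apply: leq_sum => v _; rewrite /bitlen.
Qed.

Lemma bitlen_input_length x v : v \in x -> bitlen v <= input_length x.
Proof. by move=> vx; rewrite /input_length (big_rem v) //= leq_addr. Qed.

(** Each factor is below 2 to its bit length, and bit lengths add up over the encoding. *)
Lemma prod_le_input_length (T : Type) (d : T -> nat) (f : T -> seq nat) (s : seq T) :
  (forall x, d x \in f x) ->
  \prod_(x <- s) d x <= 2 ^ input_length (flatten (map f s)).
Proof.
move=> df; elim: s => [|x s IH] /=; first by rewrite big_nil /input_length big_nil.
rewrite big_cons input_length_cat expnD; apply: leq_mul IH.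
apply: leq_trans (ltnW (bitlen_gt _)) _.
by rewrite leq_exp2l // bitlen_input_length.
Qed.

(** * From instances to covering problems and back *)

Section Instance.

Variable I : instance.

Let n := size (jobs I).
Let m := size (resources I).
Let x := encode_instance I.
Let ell := input_length x.
Let inp i := nth 0 (size x :: x) i.

Let jobs_code := flatten (map encode_job (jobs I)).
Let res_code := flatten (map encode_resource (resources I)).

Lemma size_jobs_code : size jobs_code = 4 * n.
Proof. exact: size_flatten_map. Qed.

Lemma size_res_code : size res_code = 6 * m.
Proof. exact: size_flatten_map. Qed.

Lemma size_code : size x = 3 + (4 * n + 6 * m).
Proof. by rewrite /x /= size_cat size_jobs_code size_res_code. Qed.

Lemma in_jobE (j : job_index I) k : k < 4 ->
  in_job inp (4 + k) j = nth 0 (encode_job (get_job I j)) k.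
Proof.
move=> k4; rewrite /in_job /inp (_ : 4 + k + 4 * j = (4 * j + k).+4); last by lia.
rewrite /x /= nth_cat size_jobs_code ifT; last by have := ltn_ord j; rewrite /n; lia.
rewrite (tnth_nth (get_job I j)) /=.
by rewrite (@nth_flatten_map _ _ 4 _ (get_job I j)).
Qed.

Lemma in_resE (i : res_index I) k : k < 6 ->
  in_res n inp (4 + k) i = nth 0 (encode_resource (get_res I i)) k.
Proof.
move=> k6; rewrite /in_res /inp.
rewrite (_ : 4 + k + 4 * n + 6 * i = (4 * n + (6 * i + k)).+4); last by lia.
rewrite /x /= nth_cat size_jobs_code ltnNge leq_addr /= addKn.
rewrite (tnth_nth (get_res I i)) /=.
by rewrite (@nth_flatten_map _ _ 6 _ (get_res I i)).
Qed.

Lemma inp_small i : inp i < 2 ^ ell.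
Proof.
rewrite /inp; case: i => [|i] /=.
  by apply: leq_ltn_trans (size_input_length x) _; apply: ltn_expl.
case: (ltnP i (size x)) => ix; last by rewrite nth_default // expn_gt0.
apply: leq_trans (bitlen_gt _) _.
by rewrite leq_exp2l // bitlen_input_length // mem_nth.
Qed.

Lemma by_kind_res f g (i : res_index I) : by_kind n m f g i = f i.
Proof. by rewrite /by_kind ltn_ord ltn_addr. Qed.

Lemma by_kind_job f g (j : job_index I) : by_kind n m f g (m + j) = g j.
Proof.
by rewrite /by_kind ltn_add2l ltn_ord ltnNge leq_addr /= addKn.
Qed.

Lemma sum_items F : \sum_(k < m + n) F (val k) =
  \sum_(i : res_index I) F (val i) + \sum_(j : job_index I) F (m + val j).
Proof. by rewrite big_split_ord. Qed.

Lemma res_den (i : res_index I) :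
  in_den n m inp i = absz (denq (price (get_res I i))).
Proof. by rewrite /in_den by_kind_res (@in_resE i 5). Qed.

Lemma job_den (j : job_index I) :
  in_den n m inp (m + j) = absz (denq (penalty (get_job I j))).
Proof. by rewrite /in_den by_kind_job (@in_jobE j 3). Qed.

Lemma item_ind (P : nat -> Prop) :
  (forall i : res_index I, P i) -> (forall j : job_index I, P (m + j)) ->
  forall k, k < m + n -> P k.
Proof.
move=> Pr Pj k kN; case: (ltnP k m) => km; first exact: (Pr (Ordinal km)).
have jn : k - m < n by lia.
by have := Pj (Ordinal jn); rewrite /= subnKC.
Qed.

Lemma den_pos : forall k, k < m + n -> 0 < in_den n m inp k.
Proof.
by apply: item_ind => [i|j]; rewrite ?res_den ?job_den absz_gt0 denq_eq0.
Qed.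

Lemma scale_small : in_scale n m inp < 2 ^ ell.
Proof.
rewrite /in_scale big_split_ord /=.
rewrite (eq_bigr (fun i : res_index I => absz (denq (price (get_res I i))))); last first.
  by move=> i _; exact: res_den.
rewrite [X in _ * X](eq_bigr (fun j : job_index I => absz (denq (penalty (get_job I j)))));
  last by move=> j _; exact: job_den.
have R := @prod_le_input_length _ (fun r => absz (denq (price r))) encode_resource (resources I).
have J := @prod_le_input_length _ (fun j => absz (denq (penalty j))) encode_job (jobs I).
rewrite -(big_tnth _ _ (in_tuple (resources I)) xpredT (fun r => absz (denq (price r)))).
rewrite -(big_tnth _ _ (in_tuple (jobs I)) xpredT (fun j => absz (denq (penalty j)))).
apply: (@leq_ltn_trans (2 ^ (input_length res_code + input_length jobs_code))).
  by rewrite expnD leq_mul ?R ?J // => y; rewrite !inE eqxx ?orbT.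
(* The header of the encoding makes the inequality strict. *)
rewrite ltn_exp2l // /ell /x /encode_instance input_length_cat input_length_cat.
rewrite -/jobs_code -/res_code addnC -[X in X < _]add0n ltn_add2r.
by apply: leq_trans (size_input_length _).
Qed.

Let bd := in_bd n m inp.
Let cap := in_cap n m inp.
Let u := in_u n m.
Let w := in_price n m inp.

Lemma act_item k t : k < m + n ->
  act bd k t = (in_lo n m inp k <= t < in_hi n m inp k) :> nat.
Proof.
move=> kN; rewrite actE /bd /in_bd.
have -> : (2 * k < 2 * (m + n)) = true by lia.
have -> : (2 * k + 1 < 2 * (m + n)) = true by lia.
have -> : (2 * k) %/ 2 = k by lia.
have -> : (2 * k + 1) %/ 2 = k by lia.
by rewrite eqxx (_ : (_ == _) = false) //; lia.
Qed.

Lemma act_res (i : res_index I) t : act bd i t = res_active (get_res I i) t.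
Proof.
rewrite act_item ?ltn_addr // /in_lo /in_hi !by_kind_res.
by rewrite (@in_resE i 0) // (@in_resE i 1) //= addn1 ltnS.
Qed.

Lemma act_job (j : job_index I) t : act bd (m + j) t = job_active (get_job I j) t.
Proof.
rewrite act_item ?ltn_add2l // /in_lo /in_hi !by_kind_job.
by rewrite (@in_jobE j 0) // (@in_jobE j 1) //= addn1 ltnS.
Qed.

(** The inequality is for turning solutions into covers, where raising a negative capacity to 0 only
    helps; the equality is for decoding a cover that uses positive capacities only. *)
Lemma cap_res (i : res_index I) :
  (capacity (get_res I i) <= Posz (cap i))%R
  /\ (0 < cap i -> capacity (get_res I i) = Posz (cap i)).
Proof.
rewrite /cap /in_cap by_kind_res (@in_resE i 2) // (@in_resE i 3) //=.
by case: (capacity _) => k; rewrite /= ?mul1n ?mul0n.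
Qed.

Lemma cap_jobs (j : job_index I) : cap (m + j) = 1.
Proof. by rewrite /cap /in_cap by_kind_job. Qed.

Lemma u_res (i : res_index I) : u i = n.+1.
Proof. by rewrite /u /in_u by_kind_res addn1. Qed.

Lemma u_jobs (j : job_index I) : u (m + j) = 1.
Proof. by rewrite /u /in_u by_kind_job. Qed.

Lemma demE t : dem (m + n) m bd t = \sum_(j : job_index I) job_active (get_job I j) t.
Proof.
rewrite /dem (sum_items (fun k => (m <= k) * act bd k t)) big1 ?add0n => [|i _].
  by apply: eq_bigr => j _; rewrite act_job leq_addr mul1n.
by rewrite leqNgt ltn_ord.
Qed.

Lemma covE z t : cov (m + n) bd cap z t =
  \sum_(i : res_index I) res_active (get_res I i) t * (cap i * z i)
  + \sum_(j : job_index I) job_active (get_job I j) t * z (m + j).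
Proof.
rewrite /cov (sum_items (fun k => act bd k t * (cap k * z k))); congr (_ + _).
  by apply: eq_bigr => i _; rewrite act_res.
by apply: eq_bigr => j _; rewrite act_job cap_jobs mul1n.
Qed.

Lemma job_profileE (J : {set job_index I}) t :
  job_profile J t = \sum_j (j \in J) * job_active (get_job I j) t.
Proof.
rewrite /job_profile -sum1dep_card big_mkcond; apply: eq_bigr => j _.
by rewrite mulnb; case: ifP.
Qed.

Local Open Scope ring_scope.

Lemma res_profile_le (R : {ffun res_index I -> nat}) t :
  res_profile R t <= Posz (\sum_i res_active (get_res I i) t * (cap i * R i)).
Proof.
rewrite /res_profile big_mkcond (big_morph Posz PoszD (erefl _)).
apply: ler_sum => i _; case: res_active; rewrite ?mul0n // mul1n.
by rewrite PoszM -mulr_natr natz ler_wpM2r //; have [] := cap_res i.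
Qed.

Lemma res_profileE (R : {ffun res_index I -> nat}) t :
  (forall i, (0 < R i)%N -> (0 < cap i)%N) ->
  res_profile R t = Posz (\sum_i res_active (get_res I i) t * (cap i * R i)).
Proof.
move=> Rc; rewrite /res_profile big_mkcond (big_morph Posz PoszD (erefl _)).
apply: eq_bigr => i _; case: res_active; rewrite ?mul0n // mul1n.
case: (posnP (R i)) => [-> | Ri]; first by rewrite muln0.
by rewrite PoszM -mulr_natr natz (proj2 (cap_res i) (Rc i Ri)).
Qed.

Definition decode (y : nat -> nat) : solution I :=
  Solution [ffun i : res_index I => y i] [set j : job_index I | y (m + j)%N == 0%N].

(** Each active job is either served or has its item bought. Cancelling the bought job items from
    both sides leaves the profile of the served jobs against the resources. *)
Lemma decode_feasible y :
  (forall k, (k < m + n)%N -> (y k <= u k)%N /\ ((0 < y k)%N -> (0 < cap k)%N)) ->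
  feas (m + n) m bd cap y -> feasible (decode y).
Proof.
move=> yP fy t _ /=.
rewrite res_profileE => [|i]; last first.
  by rewrite ffunE => y0; apply: (proj2 (yP i _)); rewrite ?ltn_addr.
have := feas_everywhere fy t; rewrite demE covE job_profileE lez_nat.
have -> : (\sum_(j : job_index I) job_active (get_job I j) t =
    \sum_(j : job_index I) (j \in served (decode y)) * job_active (get_job I j) t
    + \sum_(j : job_index I) job_active (get_job I j) t * y (m + j))%N.
  rewrite -big_split; apply: eq_bigr => j _ /=; rewrite inE.
  have [|yj _] := yP (m + j)%N; first by rewrite ltn_add2l.
  by move: yj; rewrite u_jobs; case: (y _) => [|[|]] //= _;
    rewrite ?mul0n ?muln0 ?mul1n ?muln1 ?addn0 ?add0n.
rewrite leq_add2r => le; apply: leq_trans le _.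
by apply: leq_sum => i _; rewrite ffunE.
Qed.

Lemma scaled_price (q : rat) (s a d : nat) :
  0 <= q -> a = absz (numq q) -> d = absz (denq q) -> (d %| s)%N ->
  (s * a %/ d)%N%:R = s%:R * q.
Proof.
move=> q0 -> -> /dvdnP[c ->].
have d0 : (0 < absz (denq q))%N by rewrite absz_gt0 denq_eq0.
rewrite mulnAC mulnK // !natrM -mulrA [_ * q]mulrC; congr (_ * _).
have E z : 0 <= z -> (absz z)%:R = z%:~R :> rat.
  by move=> z0; rewrite -[in RHS](gez0_abs z0) -pmulrn.
by rewrite !E ?denq_ge0 ?numq_ge0 // numqE.
Qed.

Lemma den_dvd k : (k < m + n)%N -> (in_den n m inp k %| in_scale n m inp)%N.
Proof. by move=> kN; rewrite /in_scale (bigD1 (Ordinal kN)) //= dvdn_mulr. Qed.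

Hypothesis vI : valid_instance I.

Let vj (j : job_index I) : valid_job (horizon I) (get_job I j).
Proof. by case/andP: vI => /(all_tnthP (t := in_tuple _)). Qed.

Let vr (i : res_index I) : valid_resource (horizon I) (get_res I i).
Proof. by case/andP: vI => _ /(all_tnthP (t := in_tuple _)). Qed.

Lemma w_res (i : res_index I) :
  (w i)%:R = (in_scale n m inp)%:R * price (get_res I i).
Proof.
apply: scaled_price.
- by case/andP: (vr i).
- by rewrite /in_num by_kind_res (@in_resE i 4).
- exact: res_den.
- by apply: den_dvd; rewrite ltn_addr.
Qed.

Lemma w_job (j : job_index I) :
  (w (m + j)%N)%:R = (in_scale n m inp)%:R * penalty (get_job I j).
Proof.
apply: scaled_price.
- by case/andP: (vj j).
- by rewrite /in_num by_kind_job (@in_jobE j 2).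
- exact: job_den.
- by apply: den_dvd; rewrite ltn_add2l.
Qed.

Lemma dot_cost (S : solution I) (z : nat -> nat) :
  (forall j : job_index I, z (m + j)%N = (j \notin served S)) ->
  (dot (m + n) w z)%:R = (in_scale n m inp)%:R *
    (\sum_i price (get_res I i) *+ z i
     + \sum_(j | j \notin served S) penalty (get_job I j)).
Proof.
move=> zS; rewrite /dot (sum_items (fun k => (w k * z k)%N)) natrD !natr_sum.
rewrite mulrDr !mulr_sumr [X in _ = _ + X]big_mkcond; congr (_ + _).
  by apply: eq_bigr => i _; rewrite natrM w_res -mulrA mulr_natr.
apply: eq_bigr => j _; rewrite natrM w_job zS.
by case: (j \notin _); rewrite ?mulr1 ?mulr0.
Qed.

(** Copies are capped to respect the multiplicity bound [u]. *)
Definition items_of (S : solution I) (k : nat) : nat :=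
  if insub k is Some i then minn (copies S i) n.+1
  else if insub (k - m)%N is Some j then nat_of_bool (j \notin served S) else 0%N.

Lemma items_of_res S (i : res_index I) : items_of S i = minn (copies S i) n.+1.
Proof. by rewrite /items_of valK. Qed.

Lemma items_of_job S (j : job_index I) : items_of S (m + j)%N = (j \notin served S).
Proof. by rewrite /items_of insubN ?addKn ?valK // -leqNgt leq_addr. Qed.

Lemma items_of_le S : forall k, (k < m + n)%N -> (items_of S k <= u k)%N.
Proof.
apply: item_ind => [i|j]; first by rewrite items_of_res u_res geq_minr.
by rewrite items_of_job u_jobs leq_b1.
Qed.

Lemma items_of_feas S : feasible S -> feas (m + n) m bd cap (items_of S).
Proof.
move=> fS q _; move: (bd q) => t; rewrite demE covE.
(* An endpoint may lie just outside the horizon, where feasibility says nothing; but there no job is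
   active. *)
case: (posnP (\sum_(j : job_index I) job_active (get_job I j) t)%N) => [-> // | d0].
have [j jt] : exists j : job_index I, job_active (get_job I j) t.
  apply/existsP; rewrite -[X in is_true X]negbK negb_exists; apply/negP => /forallP none.
  by move: d0; rewrite big1 // => j _; rewrite (negbTE (none j)).
have tT : (1 <= t <= horizon I)%N.
  case/andP: (vj j) => /and3P[j1 _ jT] _; case/andP: jt => l r.
  by rewrite (leq_trans j1 l) (leq_trans r jT).
have := le_trans (fS t tT) (res_profile_le _ _); rewrite lez_nat job_profileE => le.
have -> : (\sum_(j : job_index I) job_active (get_job I j) t =
    \sum_(j : job_index I) (j \in served S) * job_active (get_job I j) t
    + \sum_(j : job_index I) job_active (get_job I j) t * items_of S (m + j))%N.
  rewrite -big_split; apply: eq_bigr => k _ /=; rewrite items_of_job.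
  by case: (_ \in _); rewrite ?mul1n ?mul0n ?muln0 ?muln1 ?addn0.
rewrite leq_add2r.
(* If an active resource of positive capacity is capped, its remaining copies alone serve all [n]
   jobs; otherwise capping does not affect coverage at [t]. *)
case: (pickP (fun i : res_index I => [&& res_active (get_res I i) t, (0 < cap i)%N
    & (n < copies S i)%N])) => [i /and3P[it ci ni] | none].
  apply: (@leq_trans n).
    rewrite -[leqRHS]card_ord -sum1_card; apply: leq_sum => k _.
    by rewrite mulnb leq_b1.
  rewrite (bigD1 i) //= it mul1n items_of_res (minn_idPr ni).
  by apply: leq_trans (leq_addr _ _); apply: leq_trans (leqnSn n) (leq_pmull _ ci).
apply: leq_trans le _; apply: leq_sum => i _; rewrite items_of_res.
have := none i; case: res_active => //=; case: (posnP (cap i)) => [-> //|ci] /=.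
by rewrite ltnNge => /negbT; rewrite negbK => le; rewrite (minn_idPl (leqW le)).
Qed.

(** The common scale cancels, and capping copies does not raise the cost because prices are
    nonnegative. *)
Lemma decode_approx y :
  (forall k, (k < m + n)%N -> (y k <= u k)%N) ->
  (forall z, (forall k, (k < m + n)%N -> (z k <= u k)%N) ->
     feas (m + n) m bd cap z ->
     (dot (m + n) w y <= 4 * dot (m + n) w z)%N) ->
  forall S : solution I, feasible S -> cost (decode y) <= 4%:R * cost S.
Proof.
move=> yu approx S fS; have := approx _ (@items_of_le S) (items_of_feas fS).
rewrite -(ler_nat rat) natrM (@dot_cost (decode y) y) => [|j]; last first.
  have /= := yu (m + j)%N; rewrite ltn_add2l u_jobs => /(_ (ltn_ord j)).
  by rewrite inE; case: (y _) => [|[]].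
rewrite (@dot_cost S (items_of S) (items_of_job S)) mulrCA ler_pM2l; last first.
  rewrite ltr0n; apply: prodn_cond_gt0 => k _; exact: den_pos.
move=> le; rewrite /cost /=.
under eq_bigr do rewrite ffunE.
apply: le_trans le _; rewrite ler_wpM2l // lerD2r; apply: ler_sum => i _.
by rewrite items_of_res ler_wpMn2l ?geq_minl //; case/andP: (vr i).
Qed.

Lemma output_decode (s : store) y :
  s 1 0%N = (m + n)%N ->
  (forall k, (k < m + n)%N -> (y k <= u k)%N) ->
  (forall k, (k < m + n)%N -> s 1 k.+1 = if (k < m)%N then y k else (1 - y k)%N) ->
  output s = encode_solution (decode y).
Proof.
move=> s0 yu sy.
have -> : encode_solution (decode y) = [seq y (val i) | i <- enum 'I_m]
    ++ [seq nat_of_bool (y (m + val j)%N == 0%N) | j <- enum 'I_n].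
  by congr (_ ++ _); apply: eq_map => i; rewrite ?ffunE ?inE.
rewrite /output s0; apply: (@eq_from_nth _ 0%N) => [|k].
  by rewrite size_mkseq size_cat size_map size_enum_ord size_map size_enum_ord.
rewrite size_mkseq => kN; rewrite nth_mkseq // sy // nth_cat size_map size_enum_ord.
move: k kN; apply: item_ind => [i|j].
  by rewrite ltn_ord (nth_map i) ?size_enum_ord // nth_ord_enum.
have := yu (m + j)%N; rewrite ltn_add2l u_jobs => /(_ (ltn_ord j)) yj.
rewrite ltnNge leq_addr /= addKn (nth_map j) ?size_enum_ord // nth_ord_enum.
by case: (y _) yj => [|[]].
Qed.

End Instance.

(** * The approximation algorithm *)

Theorem theorem6 :
  exists A : program, approximation_algorithm (4%:R)%R A.
Proof.
have pb : poly_bounded (fun ell => ell * (ell + 3))%N.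
  apply: poly_bounded_mul; first exact: poly_bounded_id.
  apply: poly_bounded_add; [exact: poly_bounded_id | exact: poly_bounded_const].
have [p pP] := compile_poly_time prize_collecting pb poly_bounded_id.
exists (fcomp [::] 1 prize_collecting), p => I vI.
set x := encode_instance I; set ell := input_length x.
pose n := size (jobs I); pose m := size (resources I).
(* Each of the [3 + (4 * n + 6 * m)] input numbers takes at least one bit. *)
have N_ell : (2 * (m + n) + 2 <= ell)%N.
  by apply: leq_trans (size_input_length x); rewrite size_code -/n -/m; lia.
have in0 a i : a != 0%N -> input_store x a i = 0%N by rewrite /input_store => /negbTE ->.
have [sf [y [fy yu approx out0 out]]] := prize_collecting_spec
  (erefl : nth 0%N (size x :: x) 2 = n) (erefl : nth 0%N (size x :: x) 3 = m)
  (@inp_small I) N_ell (@den_pos I) (@scale_small I)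
  (erefl : input_store x 0%N = nth 0%N (size x :: x)) in0.
have bs : bounded (ell * (ell + 3)) ell (input_store x).
  split=> [a i|l]; last by rewrite in0.
  case: (eqVneq a 0%N) => [-> | a0]; last by rewrite in0 // expn_gt0.
  apply: leq_trans (@inp_small I i) _.
  by rewrite leq_exp2l // -/x -/ell; move: N_ell; nia.
have [t [r [xr tp rE]]] := pP ell (input_store x) bs sf in0.
have yle k : (k < m + n)%N -> (y k <= in_u n m k)%N by move=> kN; case: (yu k kN).
exists t, r, (decode I y); split=> //.
- apply: output_decode => //; first by rewrite -out0 -rE.
  by move=> k kN; rewrite -out // -rE.
- exact: decode_feasible.
- by move=> O [fO _]; apply: (decode_approx vI) fO.
Qed.
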